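(* For $0<a\le\frac12$ and real $x>0$, $$E_{a}(-x)=\frac{1}{a\pi}\int_{0}^{\tan\pi a}\frac{e^{-\left(x\left(\frac{\sin\pi a}{t}-\cos\pi a\right)\right)^{\frac1a}}}{1+t^{2}}\,dt ,$$ where for $a=\frac12$ the upper limit is $+\infty$.
   Context: $E_a(z)=\sum_{k=0}^{\infty}\frac{z^{k}}{\Gamma(1+ak)}$ is the Mittag-Leffler function. *)

(* Defs.v *)
From mathcomp Require Import all_boot all_order all_algebra.
From mathcomp Require Import all_classical all_reals all_analysis.

Set Implicit Arguments.
Unset Strict Implicit.
Unset Printing Implicit Defensive.

Import Order.TTheory GRing.Theory Num.Theory.
Import numFieldNormedType.Exports.

Local Open Scope classical_set_scope.
Local Open Scope ring_scope.

(* Euler's integral; it is finite exactly for 0 < s (for s <= 0 the real-valued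
   integral defaults to 0). Below, only arguments s >= 1 matter. *)
Definition Gamma {R : realType} (s : R) : R :=
  \int[lebesgue_measure]_(t in `]0, +oo[) (t `^ (s - 1) * expR (- t)).

Definition mittag_leffler_coeff {R : realType} (a z : R) (k : nat) : R :=
  z ^+ k / Gamma (1 + a * k%:R).

(* Restricted to real arguments. *)
Definition mittag_leffler {R : realType} (a z : R) : R :=
  limn (series (mittag_leffler_coeff a z)).

(* The range of integration from 0 to tan (pi a). The library's tan takes a
   default value at pi / 2, where the upper limit has to be +oo. *)
Definition tan_range {R : realType} (a : R) : set R :=
  if a == 2^-1 then [set` `]0, +oo[] else [set` `]0, tan (pi * a)[].

(* Main.v *)
Require Import Defs.
From mathcomp Require Import all_boot all_order all_algebra.
From mathcomp Require Import all_classical all_reals all_analysis.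
From mathcomp Require Import measurable_realfun complex ring lra.
Import Order.TTheory GRing.Theory Num.Theory.
Import numFieldNormedType.Exports.
Local Open Scope classical_set_scope.
Local Open Scope ring_scope.

(** Put C(s) = e^s / (1 + x s^(-a)), slit along the negative axis, and let
    arc(R) be the integral of Re C (R e^(i th)) dth over 0 <= th <= pi.
    Two readings of arc(R), as R tends to infinity, give the theorem.

    Cauchy's theorem in the upper half plane says that arc(R2) - arc(R1) is the
    integral of Im C(-r) dr/r over [R1, R2], since C is real on the positive
    axis ([sector_theorem]).  As arc(R) tends to 0 with R, the limit of arc is
    the integral of the density Im C(-r)/r over the half line
    ([Im_ml_rem0_pi]), which becomes the integral of the theorem, up to the
    factor a, under t = sin (pi a) / (r^a / x + cos (pi a))
    ([integral_ml_integrand]).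

    On the other hand C is the sum over k < m of (-x)^k e^s s^(-a k) plus the
    remainder e^s (-x s^(-a))^m / (1 + x s^(-a)).  Hankel's formula for
    1 / Gamma says that the arcs of e^s s^(-b) tend to pi / Gamma (1 + b)
    ([cvg_hankel]).  The arcs of the remainder are O(2^(-m)) uniformly in all
    large radii, because they move little once the radius is so large that
    x r^(-a) <= 1/2 ([arc_ml_rem_bound]).  Hence the limit of arc is
    pi E_a(-x) ([cvg_ml_density]).  The hypothesis a <= 1/2 keeps Re s^(-a)
    nonnegative in the upper half plane, so that 1 + x s^(-a) stays away
    from 0.

    Hankel's formula follows from the same theorem on sectors: for -1 < b < 0
    the limit is sin (- pi b) Gamma (- b), which the reflection formula turns
    into pi / Gamma (1 + b); integration by parts along the arc then raises b
    by 1 ([hankel_rec]), in step with the functional equation of Gamma.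

    The reflection formula ([gamma_reflection]) also comes from a sector.
    Tonelli gives Gamma c Gamma (1 - c) = A(c), the integral of
    r^(c - 1) / (1 + r) ([cvg_beta]).  The sector of angle al < pi, applied to
    s^c / (1 + s), turns sin (c al) A(c) into the integral of r^c against a
    positive kernel of mass al.  Convexity of c |-> r^c compares these
    integrals for c, 1/2 and 0, and at al = pi the resulting inequalities
    between phi(c) = sin (pi c) A(c), phi(1/2) = pi and pi close up thanks to
    phi(c) = phi(1 - c).

    All contours are written in logarithmic polar coordinates
    s = exp (y + i th).  Powers of s are then exponentials of linear maps, and
    dr/r is dy, so that every improper integral is a limit over [-n, n]. *)

(** * Complex-valued functions of a real variable *)

Section Complex.
Set Implicit Arguments.
Unset Strict Implicit.
Variable R : realType.
Local Open Scope complex_scope.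

Local Notation Re := complex.Re.
Local Notation Im := complex.Im.
Notation D f x l := (is_derive (x : R) (1 : R) (f : R -> R) (l : R)).

Lemma deriveM_real (f g : R -> R) x df dg : D f x df -> D g x dg ->
  D (fun t => f t * g t) x (df * g x + f x * dg).
Proof.
move=> hf hg; apply: is_derive_eq.
by rewrite /GRing.scale /= addrC mulrC.
Qed.

Lemma deriveV_real (f : R -> R) x df : f x != 0 -> D f x df ->
  D (fun t => (f t)^-1) x (- df / f x ^+ 2).
Proof.
move=> f0 hf; apply: (is_derive_eq (is_deriveV f0 hf)).
by rewrite /GRing.scale /= !mulNr mulrC.
Qed.

Lemma derive_expR_comp (f : R -> R) x df : D f x df ->
  D (fun t => expR (f t)) x (expR (f x) * df).
Proof. by move=> hf; exact: (@is_derive1_comp _ expR f). Qed.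

Lemma derive_cos_comp (f : R -> R) x df : D f x df ->
  D (fun t => cos (f t)) x (- sin (f x) * df).
Proof. by move=> hf; exact: (@is_derive1_comp _ cos f). Qed.

Lemma derive_sin_comp (f : R -> R) x df : D f x df ->
  D (fun t => sin (f t)) x (cos (f x) * df).
Proof. by move=> hf; exact: (@is_derive1_comp _ sin f). Qed.

Definition cexp (z : R[i]) : R[i] :=
  (expR (Re z) * cos (Im z)) +i* (expR (Re z) * sin (Im z)).

Definition cderive (f : R -> R[i]) (t : R) (l : R[i]) :=
  D (fun u => Re (f u)) t (Re l) /\ D (fun u => Im (f u)) t (Im l).

Definition ccontinuous (T : topologicalType) (f : T -> R[i]) (x : T) :=
  continuous_at x (fun u => Re (f u) : R) /\
  continuous_at x (fun u => Im (f u) : R).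

Lemma cReD (z w : R[i]) : Re (z + w) = Re z + Re w.
Proof. by case: z w => [a b] [c d]. Qed.
Lemma cImD (z w : R[i]) : Im (z + w) = Im z + Im w.
Proof. by case: z w => [a b] [c d]. Qed.
Lemma cReM (z w : R[i]) : Re (z * w) = Re z * Re w - Im z * Im w.
Proof. by case: z w => [a b] [c d]. Qed.
Lemma cImM (z w : R[i]) : Im (z * w) = Re z * Im w + Im z * Re w.
Proof. by case: z w => [a b] [c d] /=. Qed.
Lemma cReV (z : R[i]) : Re (z^-1) = Re z / (Re z ^+ 2 + Im z ^+ 2).
Proof. by case: z => [a b]. Qed.
Lemma cImV (z : R[i]) : Im (z^-1) = - (Im z / (Re z ^+ 2 + Im z ^+ 2)).
Proof. by case: z => [a b]. Qed.

Lemma cderive_cst c t : cderive (fun=> c) t 0.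
Proof. by split; exact: is_derive_cst. Qed.

Lemma cderiveD f g t l m : cderive f t l -> cderive g t m ->
  cderive (fun u => f u + g u) t (l + m).
Proof.
move=> [hf1 hf2] [hg1 hg2]; split.
- by under eq_fun do rewrite cReD; rewrite cReD; exact: is_deriveD.
- by under eq_fun do rewrite cImD; rewrite cImD; exact: is_deriveD.
Qed.

Lemma cderiveM f g t l m : cderive f t l -> cderive g t m ->
  cderive (fun u => f u * g u) t (l * g t + f t * m).
Proof.
move=> [hf1 hf2] [hg1 hg2]; split.
- under eq_fun do rewrite cReM.
  have h := is_deriveB (deriveM_real hf1 hg1) (deriveM_real hf2 hg2).
  by apply: (is_derive_eq h); rewrite cReD !cReM; ring.
- under eq_fun do rewrite cImM.
  have h := is_deriveD (deriveM_real hf1 hg2) (deriveM_real hf2 hg1).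
  by apply: (is_derive_eq h); rewrite cImD !cImM; ring.
Qed.

Lemma normc2_neq0 (z : R[i]) : z != 0 -> Re z ^+ 2 + Im z ^+ 2 != 0.
Proof.
case: z => [a b]; apply: contra => /=.
rewrite paddr_eq0 ?sqr_ge0// !sqrf_eq0 => /andP[/eqP-> /eqP->].
by [].
Qed.

Lemma cderiveV f t l : f t != 0 -> cderive f t l ->
  cderive (fun u => (f u)^-1) t (- l / f t ^+ 2).
Proof.
move=> f0 [h1 h2]; have n0 := normc2_neq0 f0.
have hn : D (fun u => (Re (f u) ^+ 2 + Im (f u) ^+ 2)^-1) t
   (- (2 * (Re (f t) * Re l + Im (f t) * Im l)) /
     (Re (f t) ^+ 2 + Im (f t) ^+ 2) ^+ 2).
  have h := is_deriveD (deriveM_real h1 h1) (deriveM_real h2 h2).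
  apply: (is_derive_eq (deriveV_real (f := fun u => Re (f u) ^+ 2 + Im (f u) ^+ 2) n0 h)).
  by rewrite /=; congr (- _ / _); ring.
have E2 : f t ^+ 2 = (Re (f t) ^+ 2 - Im (f t) ^+ 2) +i* (2 * (Re (f t) * Im (f t))).
  by case: (f t) => [a b]; apply/eqP; rewrite eq_complex /=; apply/andP; split;
   apply/eqP; rewrite ?expr2; ring.
have m0 : (Re (f t) ^+ 2 - Im (f t) ^+ 2) ^+ 2 + (2 * (Re (f t) * Im (f t))) ^+ 2 != 0.
  rewrite [X in X != 0](_ : _ = (Re (f t) ^+ 2 + Im (f t) ^+ 2) ^+ 2); last by ring.
  by rewrite sqrf_eq0.
split.
- under eq_fun do rewrite cReV.
  apply: (is_derive_eq (deriveM_real h1 hn)).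
  rewrite E2 cReM cReV cImV /=.
  by case: l {h1 h2 hn} => a b /=; field; rewrite n0 m0.
- under eq_fun do rewrite cImV -mulNr.
  have h2' : D (fun u => - Im (f u)) t (- Im l) by exact: is_deriveN.
  apply: (is_derive_eq (deriveM_real h2' hn)).
  rewrite E2 cImM cReV cImV /=.
  by case: l {h1 h2 h2' hn} => a b /=; field; rewrite n0 m0.
Qed.

Lemma cderive_exp f t l : cderive f t l ->
  cderive (fun u => cexp (f u)) t (l * cexp (f t)).
Proof.
move=> [h1 h2]; split => /=.
- apply: (is_derive_eq (deriveM_real (derive_expR_comp h1) (derive_cos_comp h2))).
  by rewrite cReM /=; ring.
- apply: (is_derive_eq (deriveM_real (derive_expR_comp h1) (derive_sin_comp h2))).
  by rewrite cImM /=; ring.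
Qed.

Section Continuity.
Variable T : topologicalType.
Implicit Types (f g : T -> R[i]) (x : T).

Lemma ccontinuous_cst c x : ccontinuous (fun=> c) x.
Proof. by split; exact: cvg_cst. Qed.

Lemma ccontinuousD f g x : ccontinuous f x -> ccontinuous g x ->
  ccontinuous (fun u => f u + g u) x.
Proof.
move=> [hf1 hf2] [hg1 hg2]; split.
- by under eq_fun do rewrite cReD; exact: continuousD.
- by under eq_fun do rewrite cImD; exact: continuousD.
Qed.

Lemma ccontinuousM f g x : ccontinuous f x -> ccontinuous g x ->
  ccontinuous (fun u => f u * g u) x.
Proof.
move=> [hf1 hf2] [hg1 hg2]; split.
- by under eq_fun do rewrite cReM; exact: (cvgB (cvgM hf1 hg1) (cvgM hf2 hg2)).
- by under eq_fun do rewrite cImM; exact: (cvgD (cvgM hf1 hg2) (cvgM hf2 hg1)).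
Qed.

Lemma ccontinuousV f x : f x != 0 -> ccontinuous f x ->
  ccontinuous (fun u => (f u)^-1) x.
Proof.
move=> f0 [h1 h2]; have n0 := normc2_neq0 f0.
have hn : continuous_at x (fun u => (Re (f u) ^+ 2 + Im (f u) ^+ 2)^-1 : R).
  apply: cvgV => //.
  exact: (cvgD (cvgM h1 h1) (cvgM h2 h2)).
split.
- by under eq_fun do rewrite cReV; exact: (cvgM h1 hn).
- under eq_fun do rewrite cImV.
  exact: (cvgN (cvgM h2 hn)).
Qed.

Lemma ccontinuous_exp f x : ccontinuous f x ->
  ccontinuous (fun u => cexp (f u)) x.
Proof.
move=> [h1 h2]; split => /=.
- apply: cvgM; [apply: (@continuous_comp _ _ _ _ (@expR R) x h1)|
                apply: (@continuous_comp _ _ _ _ (@cos R) x h2)].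
  + exact: continuous_expR.
  + exact: continuous_cos.
- apply: cvgM; [apply: (@continuous_comp _ _ _ _ (@expR R) x h1)|
                apply: (@continuous_comp _ _ _ _ (@sin R) x h2)].
  + exact: continuous_expR.
  + exact: continuous_sin.
Qed.

End Continuity.

End Complex.

(** * Integrals of continuous functions over segments *)

Section SegmentIntegral.
Set Implicit Arguments.
Unset Strict Implicit.
Variable R : realType.
Local Notation mu := (@lebesgue_measure R).
Notation D f x l := (is_derive (x : R) (1 : R) (f : R -> R) (l : R)).

Implicit Types (a b k M : R) (f g : R -> R).

Definition sint (a b : R) (f : R -> R) : R := \int[mu]_(t in `[a, b]) f t.

Lemma sint_integrable a b f : {in `[a, b], continuous f} ->
  mu.-integrable `[a, b] (EFin \o f).
Proof.
move=> cf; apply: continuous_compact_integrable; first exact: segment_compact.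
by apply: continuous_in_subspaceT => x /set_mem; exact: cf.
Qed.

Lemma eq_sint a b f g : {in `[a, b], f =1 g} -> sint a b f = sint a b g.
Proof. by move=> fg; apply: eq_Rintegral => x /set_mem; exact: fg. Qed.

Lemma sintD a b f g : {in `[a, b], continuous f} -> {in `[a, b], continuous g} ->
  sint a b (fun t => f t + g t) = sint a b f + sint a b g.
Proof. by move=> cf cg; apply: RintegralD => //; exact: sint_integrable. Qed.

Lemma sintZ a b k f : {in `[a, b], continuous f} ->
  sint a b (fun t => k * f t) = k * sint a b f.
Proof. by move=> cf; apply: RintegralZl => //; exact: sint_integrable. Qed.

Lemma le_sint a b f g : {in `[a, b], continuous f} -> {in `[a, b], continuous g} ->
  {in `[a, b], forall t, f t <= g t} -> sint a b f <= sint a b g.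
Proof.
move=> cf cg fg.
by apply: le_Rintegral => //; [exact: sint_integrable|exact: sint_integrable].
Qed.

Lemma sint_cst a b k : a <= b -> sint a b (fun=> k) = k * (b - a).
Proof.
move=> ab; rewrite /sint Rintegral_cst//=.
rewrite lebesgue_measure_itv/= lte_fin.
by move: ab; rewrite le_eqVlt => /predU1P[->|->//]; rewrite ltxx subrr.
Qed.

Lemma sint_norm_le_fun a b f g : {in `[a, b], continuous f} ->
  {in `[a, b], continuous g} -> {in `[a, b], forall t, `|f t| <= g t} ->
  `|sint a b f| <= sint a b g.
Proof.
move=> cf cg fg; rewrite ler_norml; apply/andP; split.
- rewrite -mulN1r -sintZ//; apply: le_sint => //.
  + by move=> t h; apply: cvgM; [exact: cvg_cst|exact: cg].
  + by move=> t /fg; rewrite mulN1r ler_norml => /andP[].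
- by apply: le_sint => // t /fg; rewrite ler_norml => /andP[].
Qed.

Lemma sint_norm_le a b f M : a <= b -> {in `[a, b], continuous f} ->
  {in `[a, b], forall t, `|f t| <= M} -> `|sint a b f| <= M * (b - a).
Proof.
move=> ab cf fM; rewrite -sint_cst//; apply: sint_norm_le_fun => // t _.
exact: cst_continuous.
Qed.

Lemma sint_FTC a b (f F : R -> R) : a <= b -> {in `[a, b], continuous f} ->
  {in `[a, b], forall t, D F t (f t)} -> sint a b f = F b - F a.
Proof.
rewrite le_eqVlt => /predU1P[->|ab] cf dF.
  by rewrite /sint set_itv1 Rintegral_set1 subrr.
have cF t : t \in `[a, b] -> {for t, continuous F}.
  move=> tab; apply: differentiable_continuous; apply/derivable1_diffP.
  by have [] := dF _ tab.
rewrite /sint /Rintegral (@continuous_FTC2 _ f F a b ab) //=.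
- by apply: continuous_in_subspaceT => x /set_mem; exact: cf.
- split.
  + by move=> x xab; have [] := dF x (subset_itv_oo_cc xab).
  + by apply: cvg_at_right_filter; apply: cF; rewrite in_itv/= lexx ltW.
  + by apply: cvg_at_left_filter; apply: cF; rewrite in_itv/= lexx ltW.
- move=> x xab; rewrite derive1E.
  by have [] := dF x (subset_itv_oo_cc xab).
Qed.

End SegmentIntegral.

(** * Holomorphic functions in logarithmic polar coordinates *)

Section Holomorphic.
Set Implicit Arguments.
Unset Strict Implicit.
Variable R : realType.
Local Open Scope complex_scope.
Local Notation Re := complex.Re.
Local Notation Im := complex.Im.

(** Here y = ln |s| and th = arg s, so that F stands for a function of
    log s = y + i th with complex derivative F' there: the last two clauses are
    the Cauchy-Riemann equations in these coordinates.  Joint continuity of the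
    derivative is what allows differentiation under the integral sign over th. *)
Definition holo (al : R) (F F' : R -> R -> R[i]) := forall y th, 0 <= th <= al ->
 [/\ ccontinuous (fun z : R * R => F z.1 z.2) (y, th),
     ccontinuous (fun z : R * R => F' z.1 z.2) (y, th),
     cderive (F^~ th) y (F' y th) & cderive (F y) th ('i * F' y th)].

Lemma holo_cst al c : holo al (fun _ _ => c) (fun _ _ => 0).
Proof.
move=> y th _; split.
- exact: ccontinuous_cst.
- exact: ccontinuous_cst.
- exact: cderive_cst.
- by rewrite mulr0; exact: cderive_cst.
Qed.

Lemma holo_id al : holo al (fun y th => y +i* th) (fun _ _ => 1).
Proof.
move=> y th _; split.
- by split => /=; [exact: cvg_fst|exact: cvg_snd].
- exact: ccontinuous_cst.
- by split => /=; [exact: is_derive_id|exact: is_derive_cst].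
- split; rewrite ?mulr1 /=; [exact: is_derive_cst|exact: is_derive_id].
Qed.

Lemma holoD al F F' G G' : holo al F F' -> holo al G G' ->
  holo al (fun y th => F y th + G y th) (fun y th => F' y th + G' y th).
Proof.
move=> hF hG y th H; have [f1 f2 f3 f4] := hF y th H.
have [g1 g2 g3 g4] := hG y th H; split.
- exact: (ccontinuousD f1 g1).
- exact: (ccontinuousD f2 g2).
- exact: (cderiveD f3 g3).
- by rewrite mulrDr; exact: cderiveD.
Qed.

Lemma holoM al F F' G G' : holo al F F' -> holo al G G' ->
  holo al (fun y th => F y th * G y th)
          (fun y th => F' y th * G y th + F y th * G' y th).
Proof.
move=> hF hG y th H; have [f1 f2 f3 f4] := hF y th H.
have [g1 g2 g3 g4] := hG y th H; split.
- exact: (ccontinuousM f1 g1).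
- exact: (ccontinuousD (ccontinuousM f2 g1) (ccontinuousM f1 g2)).
- exact: (cderiveM f3 g3).
- rewrite mulrDr mulrA (mulrCA 'i); exact: cderiveM.
Qed.

Lemma holoV al F F' : (forall y th, 0 <= th <= al -> F y th != 0) ->
  holo al F F' ->
  holo al (fun y th => (F y th)^-1) (fun y th => - F' y th * (F y th ^+ 2)^-1).
Proof.
move=> F0 hF y th H; have [f1 f2 f3 f4] := hF y th H; split.
- exact: (ccontinuousV (F0 _ _ H) f1).
- have n1 : ccontinuous (fun z : R * R => - F' z.1 z.2) (y, th).
    have -> : (fun z : R * R => - F' z.1 z.2) = (fun z => (-1) * F' z.1 z.2).
      by apply/funext => z; rewrite mulN1r.
    apply: ccontinuousM f2; exact: ccontinuous_cst.
  apply: ccontinuousM n1 _; apply: ccontinuousV; first by rewrite expf_neq0 ?F0.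
  exact: (ccontinuousM f1 f1).
- exact: (cderiveV (F0 _ _ H) f3).
- rewrite mulrA mulrN; exact: (cderiveV (F0 _ _ H) f4).
Qed.

Lemma holo_exp al F F' : holo al F F' ->
  holo al (fun y th => cexp (F y th)) (fun y th => F' y th * cexp (F y th)).
Proof.
move=> hF y th H; have [f1 f2 f3 f4] := hF y th H; split.
- exact: (ccontinuous_exp f1).
- exact: (ccontinuousM f2 (ccontinuous_exp f1)).
- exact: (cderive_exp f3).
- by rewrite mulrA; exact: (cderive_exp f4).
Qed.

End Holomorphic.

(** * The theorem of Cauchy on annular sectors *)

Section SectorTheorem.
Set Implicit Arguments.
Unset Strict Implicit.
Variable R : realType.
Local Open Scope complex_scope.
Local Notation Re := complex.Re.
Local Notation Im := complex.Im.
Local Notation mu := (@lebesgue_measure R).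
Notation D f x l := (is_derive (x : R) (1 : R) (f : R -> R) (l : R)).

Lemma continuous_slice_th (f : R -> R -> R) (y th : R) :
  continuous_at (y, th) (fun z : R * R => f z.1 z.2) -> continuous_at th (f y).
Proof.
move=> cf.
exact: (continuous2_cvg _ cf (cvg_cst y) (@cvg_id _ (nbhs th))).
Qed.

Lemma continuous_slice_y (f : R -> R -> R) (y th : R) :
  continuous_at (y, th) (fun z : R * R => f z.1 z.2) -> continuous_at y (f ^~ th).
Proof.
move=> cf.
exact: (continuous2_cvg _ cf (@cvg_id _ (nbhs y)) (cvg_cst th)).
Qed.

Variables (al : R) (F F' : R -> R -> R[i]).
Hypothesis al0 : 0 <= al.
Hypothesis hF : holo al F F'.

(** The dominating constant for differentiating under the integral sign: a
    continuous function is bounded on a compact rectangle. *)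
Lemma holo_bounded (y : R) : exists2 M : R, 0 <= M &
  forall u th, u \in `[y - 1, y + 1] -> th \in `[0, al] -> `|Re (F' u th)| <= M.
Proof.
have cK : compact (`[y - 1, y + 1] `*` `[0, al] : set (R * R)).
  by apply: compact_setX; exact: segment_compact.
have cf : {within `[y - 1, y + 1] `*` `[0, al],
    continuous (fun z : R * R => Re (F' z.1 z.2) : R)}.
  apply: continuous_in_subspaceT => -[u th] /set_mem[/= _ tal].
  by have [_ [h _] _ _] := hF u tal.
have /compact_bounded[M [_ hM]] := continuous_compact cf cK.
exists `|M + 1| => // u th ? ?.
apply: (hM (`|M + 1|)); last by exists (u, th).
by rewrite (lt_le_trans _ (ler_norm _))// ltrDl.
Qed.

Lemma holo_continuous_ReF y : {in `[0, al], continuous (fun th => Re (F y th) : R)}.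
Proof.
move=> th tal; have [[h _] _ _ _] := hF y tal.
exact: (continuous_slice_th (f := fun y th => Re (F y th)) h).
Qed.

Lemma holo_continuous_ImFy th : th \in `[0, al] -> continuous (fun y => Im (F y th) : R).
Proof.
move=> tal y; have [[_ h] _ _ _] := hF y tal.
exact: (continuous_slice_y (f := fun y th => Im (F y th)) h).
Qed.

(** The y-derivative of Re F is also the th-derivative of Im F, so that the
    differentiated integral is exact. *)
Lemma holo_derive_sint y :
  D (fun y => sint 0 al (fun th => Re (F y th))) y (Im (F y al) - Im (F y 0)).
Proof.
have [M M0 hM] := holo_bounded y.
have Iy : [set` `]y - 1, y + 1[] y by rewrite /= in_itv/= ltrBlDr ltrDl ltr01.
pose f := fun u th => Re (F u th) : R.
have dfu u th : th \in `[0, al] -> D (fun u => f u th) u (Re (F' u th)).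
  by move=> tal; have [_ _ [h _] _] := hF u tal.
have h1 u : [set` `]y - 1, y + 1[] u -> mu.-integrable `[0, al] (EFin \o f u).
  by move=> _; apply: sint_integrable; exact: holo_continuous_ReF.
have h2 u th : [set` `]y - 1, y + 1[] u -> [set` `[0, al]] th -> derivable (f ^~ th) u 1.
  by move=> _ tal; have [] := dfu u th tal.
have h3 : mu.-integrable `[0, al] (EFin \o cst M).
  by apply: sint_integrable => t _; exact: cst_continuous.
have E1 u th : th \in `[0, al] -> partial1of2 f u th = Re (F' u th).
  by move=> tal; rewrite partial1of2E; have [] := dfu u th tal.
have h4 u th : [set` `]y - 1, y + 1[] u -> [set` `[0, al]] th ->
    `|partial1of2 f u th| <= cst M th.
  by move=> uy tal; rewrite E1//; apply: hM => //; exact: subset_itv_oo_cc.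
apply: DeriveDef.
  exact: (derivable_under_integral _ Iy h1 h2 _ h3 h4).
rewrite -derive1E (differentiation_under_integral _ Iy h1 h2 _ h3 h4)//.
rewrite -[LHS]/(sint 0 al (fun th => partial1of2 f y th)).
rewrite (eq_sint (g := fun th => Re (F' y th))); last by move=> th tal; rewrite E1.
apply: (sint_FTC (F := fun th => Im (F y th))) => //.
- move=> th tal; have [_ [h _] _ _] := hF y tal.
  exact: (continuous_slice_th (f := fun y th => Re (F' y th)) h).
- move=> th tal; have [_ _ _ [_ h]] := hF y tal.
  by apply: (is_derive_eq h); rewrite cImM /= mul0r add0r mul1r.
Qed.

(** The real part of the vanishing of the integral of F ds/s around the
    boundary of the sector e^y1 <= |s| <= e^y2, 0 <= arg s <= al. *)
Lemma sector_theorem y1 y2 : y1 <= y2 ->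
  sint 0 al (fun th => Re (F y2 th)) - sint 0 al (fun th => Re (F y1 th)) =
  sint y1 y2 (fun y => Im (F y al) - Im (F y 0)).
Proof.
move=> y12; symmetry.
apply: (sint_FTC (F := fun y => sint 0 al (fun th => Re (F y th)))) => //.
- move=> t _; apply: cvgB; apply: holo_continuous_ImFy;
  by rewrite in_itv/= lexx al0.
- by move=> t _; exact: holo_derive_sint.
Qed.

End SectorTheorem.

(** * Change of variables and exhaustion by segments *)

Section Improper.
Set Implicit Arguments.
Unset Strict Implicit.
Variable R : realType.
Local Notation mu := (@lebesgue_measure R).
Notation D f x l := (is_derive (x : R) (1 : R) (f : R -> R) (l : R)).
Implicit Types (f g phi : R -> R) (a b c k l y : R) (u v : nat -> R).

Lemma is_derive_continuous f x l : D f x l -> {for x, continuous f}.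
Proof.
by move=> [h _]; apply: differentiable_continuous; exact/derivable1_diffP.
Qed.

Lemma derive1_fun f g : (forall t, D f t (g t)) -> derive1 f = g.
Proof. by move=> h; apply/funext => t; rewrite derive1E; have [] := h t. Qed.

Lemma sint_subst_increasing phi dphi f a b : a <= b ->
  (forall t, D phi t (dphi t)) -> continuous dphi ->
  {homo phi : x y / x < y} ->
  {in `[phi a, phi b], continuous f} ->
  sint (phi a) (phi b) f = sint a b (fun t => f (phi t) * dphi t).
Proof.
move=> ab hphi cdphi iphi cf.
have E := derive1_fun hphi.
have cphi t : {for t, continuous phi} by exact: is_derive_continuous (hphi t).
rewrite /sint /Rintegral integration_by_substitution_increasing ?E//.
- by move=> x y _ _; exact: iphi.
- exact: (cvgP _ (cvg_at_right_filter (cdphi a))).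
- exact: (cvgP _ (cvg_at_left_filter (cdphi b))).
- split.
  + by move=> x _; have [] := hphi x.
  + by apply: cvg_at_right_filter; exact: cphi.
  + by apply: cvg_at_left_filter; exact: cphi.
- by apply: continuous_in_subspaceT => x /set_mem; exact: cf.
Qed.

Lemma sint_subst_decreasing phi dphi f a b : a <= b ->
  (forall t, D phi t (dphi t)) -> continuous dphi ->
  {homo phi : x y /~ x < y} ->
  {in `[phi b, phi a], continuous f} ->
  sint (phi b) (phi a) f = sint a b (fun t => f (phi t) * - dphi t).
Proof.
move=> ab hphi cdphi iphi cf.
have E := derive1_fun hphi.
have cphi t : {for t, continuous phi} by exact: is_derive_continuous (hphi t).
rewrite /sint /Rintegral integration_by_substitution_decreasing ?E//.
- by move=> x y _ _; exact: iphi.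
- exact: (cvgP _ (cvg_at_right_filter (cdphi a))).
- exact: (cvgP _ (cvg_at_left_filter (cdphi b))).
- split.
  + by move=> x _; have [] := hphi x.
  + by apply: cvg_at_right_filter; exact: cphi.
  + by apply: cvg_at_left_filter; exact: cphi.
- by apply: continuous_in_subspaceT => x /set_mem; exact: cf.
Qed.

Section Exhaustion.
Variables (B : set R) (f : R -> R) (u v : nat -> R).
Hypothesis ui : {homo u : n m / (n <= m)%N >-> m <= n}.
Hypothesis vi : {homo v : n m / (n <= m)%N >-> n <= m}.
Hypothesis BE : B = \bigcup_n `[u n, v n]%classic.
Hypothesis f0 : forall t, B t -> 0 <= f t.
Hypothesis cf : forall t, B t -> {for t, continuous f}.

Let sub n t : t \in `[u n, v n] -> B t.
Proof. by move=> tn; rewrite BE; exists n. Qed.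

Let cfn n : {in `[u n, v n], continuous f}.
Proof. by move=> t /sub; exact: cf. Qed.

Let EFin_sint n : (\int[mu]_(t in `[u n, v n]) (f t)%:E = (sint (u n) (v n) f)%:E)%E.
Proof.
rewrite /sint /Rintegral fineK//; apply: integrable_fin_num => //.
exact: sint_integrable.
Qed.

Let sub_itv n m : (n <= m)%N -> `[u n, v n]%classic `<=` `[u m, v m]%classic.
Proof.
move=> nm t /=; rewrite !in_itv/= => /andP[h1 h2].
by rewrite (le_trans (ui nm) h1) (le_trans h2 (vi nm)).
Qed.

Let cvg_exhaustion :
  ((sint (u n) (v n) f)%:E @[n --> \oo] --> \int[mu]_(t in B) (f t)%:E)%E.
Proof.
rewrite BE; under eq_fun do rewrite -EFin_sint.
apply: ge0_nondecreasing_set_cvg_integral => //.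
- move=> n m nm; rewrite subsetEset; exact: sub_itv.
- move=> n; have /integrableP[h _] := sint_integrable (@cfn n); exact: h.
- by move=> n t /sub tB; rewrite lee_fin f0.
Qed.

(** Monotone convergence identifies the integral over B with the limit of the
    integrals over the segments that exhaust it. *)
Lemma integral_exhaustion l :
  sint (u n) (v n) f @[n --> \oo] --> l -> (\int[mu]_(t in B) (f t)%:E = l%:E)%E.
Proof.
move=> h; apply: (cvg_unique _ cvg_exhaustion) => //.
by apply: cvg_EFin => //; exact: nearW.
Qed.

Lemma cvg_integral_exhaustion l :
  (\int[mu]_(t in B) (f t)%:E = l%:E)%E -> sint (u n) (v n) f @[n --> \oo] --> l.
Proof.
move=> h.
have := cvg_exhaustion; rewrite h => /fine_cvgP[_]; exact.
Qed.

Lemma nondecreasing_exhaustion n m : (n <= m)%N ->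
  sint (u n) (v n) f <= sint (u m) (v m) f.
Proof.
move=> nm; rewrite -lee_fin -!EFin_sint.
apply: ge0_subset_integral => //.
- have /integrableP[h _] := sint_integrable (@cfn m); exact: h.
- by move=> t /sub tB; rewrite lee_fin f0.
- exact: sub_itv.
Qed.

(** The integrals of a nonnegative function over growing segments increase. *)
Lemma is_cvg_exhaustion M : (forall n, sint (u n) (v n) f <= M) ->
  exists l, sint (u n) (v n) f @[n --> \oo] --> l.
Proof.
move=> hM; apply/cvg_ex; apply: nondecreasing_is_cvgn.
  by move=> n m; exact: nondecreasing_exhaustion.
by exists M => _ [n _ <-].
Qed.

End Exhaustion.

Lemma setT_bigcup_itv : [set: R] = \bigcup_n `[(- n%:R : R), n%:R]%classic.
Proof.
apply/seteqP; split => // t _.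
exists (Num.truncn `|t|).+1 => //=.
rewrite in_itv/= -ler_norml ltW//.
by rewrite truncnS_gt.
Qed.

Lemma homo_natr : {homo (fun n => n%:R : R) : n m / (n <= m)%N >-> n <= m}.
Proof. by move=> n m nm; rewrite ler_nat. Qed.

Lemma homo_natrN : {homo (fun n => - n%:R : R) : n m / (n <= m)%N >-> m <= n}.
Proof. by move=> n m nm; rewrite lerN2 ler_nat. Qed.

Lemma natr_symm (n : nat) : - n%:R <= n%:R :> R.
Proof. by rewrite (@le_trans _ _ 0) ?oppr_le0. Qed.

Lemma cvg_expRN k : 0 < k -> expR (- (k * n%:R)) @[n --> \oo] --> (0 : R).
Proof.
move=> k0.
have -> : (fun n => expR (- (k * n%:R))) = (fun n => expR (- k) ^+ n).
  by apply/funext => n; rewrite -expRM_natr mulNr.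
apply: cvg_expr; rewrite ger0_norm ?expR_ge0//.
by rewrite -expR0 ltr_expR oppr_lt0.
Qed.

End Improper.

(** * The Gamma integral in logarithmic coordinates *)

Section GammaIntegral.
Set Implicit Arguments.
Unset Strict Implicit.
Variable R : realType.
Local Notation mu := (@lebesgue_measure R).
Notation D f x l := (is_derive (x : R) (1 : R) (f : R -> R) (l : R)).
Implicit Types (f g phi : R -> R) (a b c k l y : R) (u v : nat -> R).

(** The integrand of Gamma b after the substitution t = e^y, where dt/t = dy. *)
Definition log_gamma_integrand b y : R := expR (b * y - expR y).

Definition symm_int f (n : nat) : R := sint (- n%:R) n%:R f.

Lemma derive_mull b y : D (fun y => b * y) y b.
Proof.
apply: (is_derive_eq (deriveM_real (is_derive_cst b y 1) (is_derive_id y 1))).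
by rewrite mul0r add0r mulr1.
Qed.

Lemma derive_1Dexp b y : D (fun y => 1 + expR (b * y)) y (expR (b * y) * b).
Proof.
have h := is_deriveD (is_derive_cst (1 : R) y 1) (derive_expR_comp (derive_mull b y)).
by apply: (is_derive_eq h); rewrite add0r.
Qed.

Lemma derive_lgi b y :
  D (log_gamma_integrand b) y (b * log_gamma_integrand b y - log_gamma_integrand (b + 1) y).
Proof.
rewrite /log_gamma_integrand.
have h : D (fun y => b * y - expR y) y (b - expR y).
  by apply: is_deriveB; exact: derive_mull.
apply: (is_derive_eq (derive_expR_comp h)).
rewrite mulrBr (mulrC _ b); congr (_ - _).
by rewrite -expRD; congr expR; ring.
Qed.

Lemma continuous_lgi b : continuous (log_gamma_integrand b).
Proof. by move=> y; exact: is_derive_continuous (derive_lgi b y). Qed.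

Lemma lgi_ge0 b y : 0 <= log_gamma_integrand b y.
Proof. exact: expR_ge0. Qed.

Lemma lgi_exponent_bound b : 0 < b ->
  exists C, forall y, b * y - expR y / 2 <= C.
Proof.
move=> b0; exists (b * (ln (2 * b) - 1)) => y.
(* 2 b e^(y - ln (2 b)) >= 2 b (1 + y - ln (2 b)), and half of the right side is b y
   plus a constant. *)
have E : expR y = 2 * b * expR (y - ln (2 * b)).
  by rewrite expRD expRN lnK ?posrE ?mulr_gt0// mulrCA divff ?mulr1 ?gt_eqF ?mulr_gt0.
have h := expR_ge1Dx (y - ln (2 * b)).
have h2 : b * (1 + (y - ln (2 * b))) <= b * expR (y - ln (2 * b)) by rewrite ler_pM2l.
rewrite E; lra.
Qed.

(** The integrand is at most K e^(b y) / (1 + e^(b y))^2, which has the bounded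
    primitive - (K / b) / (1 + e^(b y)); this treats both ends of the line
    together. *)
Lemma lgi_bounded b : 0 < b -> exists M, forall n, symm_int (log_gamma_integrand b) n <= M.
Proof.
move=> b0; have [C hC] := lgi_exponent_bound b0.
pose K := (1 + expR C) ^+ 2.
pose F y := - (K / b) * (1 + expR (b * y))^-1.
pose f y := K * expR (b * y) / (1 + expR (b * y)) ^+ 2.
have p0 y : 0 < 1 + expR (b * y) by rewrite addr_gt0// expR_gt0.
have dF y : D F y (f y).
  have h := derive_1Dexp b y.
  have h2 := deriveV_real (f := fun y => 1 + expR (b * y)) (lt0r_neq0 (p0 y)) h.
  apply: (is_derive_eq (deriveM_real (is_derive_cst (- (K / b)) y 1) h2)).
  by rewrite /f /=; field; rewrite !gt_eqF.
have cf : continuous f.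
  move=> y; rewrite /f; apply: cvgM; last first.
    apply: cvgV; first by rewrite expf_neq0// gt_eqF.
    have h := derive_1Dexp b y.
    by apply: cvgM; exact: (is_derive_continuous h).
  apply: cvgM; first exact: cvg_cst.
  exact: (is_derive_continuous (derive_expR_comp (derive_mull b y))).
exists (K / b) => n; apply: (@le_trans _ _ (symm_int f n)).
  apply: le_sint => [t _|t _|t _].
  - exact: continuous_lgi.
  - exact: cf.
  - rewrite /f ler_pdivlMr ?exprn_gt0//.
    rewrite /log_gamma_integrand expRD -mulrA [leRHS]mulrC ler_pM2l ?expR_gt0//.
    (* Half of the decay of exp (- e^t) absorbs each factor 1 + e^(b t). *)
    rewrite (_ : expR (- expR t) = expR (- (expR t / 2)) ^+ 2); last first.
      by rewrite -expRM_natr; congr expR; lra.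
    rewrite -exprMn /K; apply: lerXn2r.
    + by rewrite nnegrE mulr_ge0 ?addr_ge0 ?expR_ge0.
    + by rewrite nnegrE addr_ge0 ?expR_ge0.
    + rewrite mulrDr mulr1 -expRD lerD//.

      by rewrite ler_expR addrC.
have -> : symm_int f n = F n%:R - F (- n%:R).
  by apply: sint_FTC => [|t _|t _]; [exact: natr_symm|exact: cf|exact: dF].
have Kb : 0 < K / b by rewrite divr_gt0// exprn_gt0// addr_gt0 ?expR_gt0.
rewrite /F !mulNr opprK addrC.
rewrite (@le_trans _ _ ((K / b) * 1))//; last by rewrite mulr1.
rewrite (@le_trans _ _ (K / b * (1 + expR (b * - n%:R))^-1))//.
  by rewrite gerBl mulr_ge0 ?invr_ge0 ?ltW// addr_gt0 ?expR_gt0.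
by rewrite ler_pM2l// invf_le1 ?lerDl ?expR_ge0// addr_gt0 ?expR_gt0.
Qed.

Lemma powR_expR b y : expR y `^ b = expR (b * y).
Proof. by rewrite /powR gt_eqF ?expR_gt0// expRK. Qed.

Lemma gamma_integrand_continuous b t : 0 < t ->
  {for t, continuous (fun t => t `^ (b - 1) * expR (- t) : R)}.
Proof.
move=> t0; have hN : D (fun t => - t) t (- 1) by exact: is_deriveN.
exact: (cvgM (is_derive_continuous (is_derive1_powR (b - 1) t0))
             (is_derive_continuous (derive_expR_comp hN))).
Qed.

Lemma gamma_subst b n :
  sint (expR (- n%:R)) (expR n%:R) (fun t => t `^ (b - 1) * expR (- t)) =
  symm_int (log_gamma_integrand b) n.
Proof.
rewrite (sint_subst_increasing (phi := expR) (dphi := expR)) ?natr_symm//.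
- apply: eq_sint => y _; rewrite powR_expR -!expRD; congr expR; ring.
- exact: continuous_expR.
- by move=> x y; rewrite ltr_expR.
- move=> t; rewrite in_itv/= => /andP[h _].
  have t0 : 0 < t by rewrite (lt_le_trans _ h)// expR_gt0.
  exact: gamma_integrand_continuous.
Qed.

Lemma bigcup_itv_expR : [set` `]0, +oo[] =
  \bigcup_n `[expR (- n%:R), expR n%:R]%classic :> set R.
Proof.
apply/seteqP; split => t /=.
  rewrite in_itv/= andbT => t0.
  have : [set: R] (ln t) by [].
  rewrite setT_bigcup_itv => -[n _ /=]; rewrite in_itv/= => /andP[h1 h2].
  by exists n => //=; rewrite in_itv/= -ler_ln ?posrE ?expR_gt0// expRK h1
    -[leLHS]lnK ?posrE// ler_expR.
move=> [n _ /=]; rewrite !in_itv/= => /andP[h _].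
by rewrite (lt_le_trans _ h)// expR_gt0.
Qed.

Lemma cvg_gamma b : 0 < b -> symm_int (log_gamma_integrand b) n @[n --> \oo] --> Gamma b.
Proof.
move=> b0; have [M hM] := lgi_bounded b0.
have [l hl] : exists l, symm_int (log_gamma_integrand b) n @[n --> \oo] --> l.
  apply: (is_cvg_exhaustion (@homo_natrN R) (@homo_natr R) (setT_bigcup_itv R) _ _ hM).
  - by move=> t _; exact: lgi_ge0.
  - by move=> t _; exact: continuous_lgi.
suff -> : Gamma b = l by [].
rewrite /Gamma /Rintegral.
rewrite (@integral_exhaustion _ _ _ (fun n => expR (- n%:R)) (fun n => expR n%:R) _ _ bigcup_itv_expR _ _ l)//.
- by move=> n m nm; rewrite ler_expR lerN2 ler_nat.
- by move=> n m nm; rewrite ler_expR ler_nat.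
- by move=> t _; rewrite mulr_ge0 ?powR_ge0 ?expR_ge0.
- move=> t /=; rewrite in_itv/= andbT => t0.
  exact: gamma_integrand_continuous.
- by under eq_fun do rewrite gamma_subst.
Qed.

Lemma integral_lgi b : 0 < b -> (\int[mu]_y (log_gamma_integrand b y)%:E = (Gamma b)%:E)%E.
Proof.
move=> b0.
apply: (integral_exhaustion (@homo_natrN R) (@homo_natr R) (setT_bigcup_itv R)).
- by move=> t _; exact: lgi_ge0.
- by move=> t _; exact: continuous_lgi.
- exact: cvg_gamma.
Qed.

Lemma cvg_lgi_boundary b : 0 < b ->
  log_gamma_integrand b n%:R - log_gamma_integrand b (- n%:R) @[n --> \oo] --> (0 : R).
Proof.
move=> b0; have [C hC] := lgi_exponent_bound b0.
rewrite -[X in _ --> X](subr0 0); apply: cvgB.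
- have h : expR C * expR (- (2^-1 * n%:R)) @[n --> \oo] --> expR C * 0.
    by apply: cvgM; [exact: cvg_cst|apply: cvg_expRN; rewrite invr_gt0].
  rewrite mulr0 in h.
  apply: (squeeze_cvgr _ (cvg_cst 0) h).
  apply: nearW => n; rewrite lgi_ge0/= -expRD ler_expR.
  have := hC n%:R; have := expR_ge1Dx (n%:R : R); lra.
- apply: (squeeze_cvgr _ (cvg_cst 0) (cvg_expRN b0)).
  apply: nearW => n; rewrite lgi_ge0/= ler_expR mulrN.
  by rewrite gerBl expR_ge0.
Qed.

(** The difference b log_gamma_integrand b - log_gamma_integrand (b + 1) is the
    derivative of log_gamma_integrand b, which vanishes at both ends. *)
Lemma gamma_rec b : 0 < b -> Gamma (b + 1) = b * Gamma b.
Proof.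
move=> b0.
have h : b * symm_int (log_gamma_integrand b) n - symm_int (log_gamma_integrand (b + 1)) n
    @[n --> \oo] --> b * Gamma b - Gamma (b + 1).
  apply: cvgB; last by apply: cvg_gamma; rewrite addr_gt0.
  by apply: cvgM; [exact: cvg_cst|exact: cvg_gamma].
have E n : b * symm_int (log_gamma_integrand b) n - symm_int (log_gamma_integrand (b + 1)) n
    = log_gamma_integrand b n%:R - log_gamma_integrand b (- n%:R).
  rewrite -(sint_FTC (f := fun y => b * log_gamma_integrand b y - log_gamma_integrand (b + 1) y))
     ?natr_symm//.
  - rewrite -[X in _ - X]mul1r -mulNr /symm_int -!sintZ; try by move=> t _; exact: continuous_lgi.
    rewrite -sintD; first by apply: eq_sint => t _; rewrite mulN1r.
    + by move=> t _; apply: cvgM; [exact: cvg_cst|exact: continuous_lgi].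
    + by move=> t _; apply: cvgM; [exact: cvg_cst|exact: continuous_lgi].
  - move=> t _; apply: cvgB; last exact: continuous_lgi.
    by apply: cvgM; [exact: cvg_cst|exact: continuous_lgi].
  - by move=> t _; exact: derive_lgi.
move: h; under eq_fun do rewrite E.
move=> /(cvg_unique _ (cvg_lgi_boundary b0)) => /(_ (@norm_hausdorff _ _)) h.
by apply/eqP; rewrite -subr_eq0 -oppr_eq0 opprB -h.
Qed.

Lemma gamma1 : Gamma 1 = 1 :> R.
Proof.
have h := cvg_gamma (@ltr01 R).
suff h' : symm_int (log_gamma_integrand 1) n @[n --> \oo] --> (1 : R).
  exact: (cvg_unique (@norm_hausdorff _ _) h h').
have E n : symm_int (log_gamma_integrand 1) n = expR (- expR (- n%:R)) - expR (- expR n%:R).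
  rewrite /symm_int (sint_FTC (F := fun y => - expR (- expR y))) ?natr_symm//.
  - by rewrite opprK addrC.
  - by move=> t _; exact: continuous_lgi.
  - move=> t _.
    have h1 : D (fun y => - expR y) t (- expR t) by exact: is_deriveN.
    have h2 := is_deriveN (derive_expR_comp h1).
    apply: (is_derive_eq h2).
    by rewrite mulrN opprK -expRD /log_gamma_integrand mul1r addrC.
have z := cvg_expRN (@ltr01 R).
rewrite (_ : symm_int _ = fun n => expR (- expR (- n%:R)) - expR (- expR n%:R)); last exact/funext.
rewrite -[X in _ --> X](subr0 1); apply: cvgB.
- rewrite -[X in _ --> X]expR0 -oppr0.
  apply: (@continuous_cvg _ _ _ _ _ _ (@expR R)); first exact: continuous_expR.
  by apply: cvgN; move: z; under eq_fun do rewrite mul1r.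
- apply: (squeeze_cvgr _ (cvg_cst 0) z).
  apply: nearW => n; rewrite expR_ge0/= mul1r ler_expR lerN2.
  by apply: le_trans (expR_ge1Dx _); rewrite lerDr.
Qed.

End GammaIntegral.

(** * The Beta integral of c and 1 - c *)

Section Beta.
Set Implicit Arguments.
Unset Strict Implicit.
Variable R : realType.
Local Notation mu := (@lebesgue_measure R).
Notation D f x l := (is_derive (x : R) (1 : R) (f : R -> R) (l : R)).
Implicit Types (f g phi : R -> R) (a b c k l y z : R) (u v : nat -> R).

(** The integrand r^c / (1 + r) dr/r in the variable r = e^y. *)
Definition beta_integrand c y : R := expR (c * y) / (1 + expR y).

Lemma beta_integrand_ge0 c y : 0 <= beta_integrand c y.
Proof. by rewrite divr_ge0 ?addr_ge0 ?expR_ge0. Qed.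

Lemma continuous_expR_mul c : continuous (fun y => expR (c * y) : R).
Proof. by move=> y; exact: is_derive_continuous (derive_expR_comp (derive_mull c y)). Qed.

Lemma continuous_beta_integrand c : continuous (beta_integrand c).
Proof.
move=> y; apply: cvgM; first exact: continuous_expR_mul.
apply: cvgV; first by rewrite gt_eqF// addr_gt0 ?expR_gt0.
by apply: cvgD; [exact: cvg_cst|exact: continuous_expR].
Qed.

Lemma integral_lgi_shift b z : 0 < b ->
  (\int[mu]_y (log_gamma_integrand b (y + z))%:E = (Gamma b)%:E)%E.
Proof.
move=> b0.
apply: (integral_exhaustion (@homo_natrN R) (@homo_natr R) (setT_bigcup_itv R)).
- by move=> t _; exact: lgi_ge0.
- move=> t _; apply: (@continuous_comp _ _ _ (fun y => y + z) (log_gamma_integrand b)).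
    by apply: cvgD; [exact: cvg_id|exact: cvg_cst].
  exact: continuous_lgi.
- have h := @cvg_integral_exhaustion _ [set: R] (log_gamma_integrand b)
    (fun n => - n%:R + z) (fun n => n%:R + z) _ _ _ _ _ (Gamma b) (integral_lgi b0).
  have -> : (fun n => sint (- n%:R) n%:R (fun t => log_gamma_integrand b (t + z))) =
      fun n => sint (- n%:R + z) (n%:R + z) (log_gamma_integrand b).
    apply/funext => n.
    have hphi t : D (fun y => y + z) t 1.
      apply: (is_derive_eq (is_deriveD (is_derive_id t (1 : R)) (is_derive_cst z t (1 : R)))).
      by rewrite addr0.
    rewrite (@sint_subst_increasing _ (fun y => y + z) (fun=> 1) _ _ _ (natr_symm R n) hphi).
    + by apply: eq_sint => y _; rewrite mulr1.
    + by move=> t; exact: cst_continuous.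
    + by move=> x y; rewrite ltrD2r.
    + by move=> t _; exact: continuous_lgi.
  apply: h.
  + by move=> n m nm; rewrite lerD2r; exact: homo_natrN.
  + by move=> n m nm; rewrite lerD2r; exact: homo_natr.
  + apply/seteqP; split => // t _.
    have : [set: R] (t - z) by [].
    rewrite setT_bigcup_itv => -[n _ /=]; rewrite in_itv/= => /andP[h1 h2].
    by exists n => //=; rewrite in_itv/= -lerBrDr h1 -lerBlDr.
  + by move=> t _; exact: lgi_ge0.
  + by move=> t _; exact: continuous_lgi.
Qed.

(** The integral of exp (- k r) dr over the half line. *)
Lemma integral_exp_exp k : 0 < k ->
  (\int[mu]_z (expR (z - k * expR z))%:E = (k^-1)%:E)%E.
Proof.
move=> k0.
have dF z : D (fun z => - k^-1 * expR (- k * expR z)) z (expR (z - k * expR z)).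
  have h := derive_expR_comp (deriveM_real (is_derive_cst (- k) z (1 : R)) (is_derive_expR z)).
  apply: (is_derive_eq (deriveM_real (is_derive_cst (- k^-1) z (1 : R)) h)).
  by rewrite expRD mulNr /=; field; rewrite gt_eqF.
have cf : continuous (fun z => expR (z - k * expR z) : R).
  move=> z; apply: (@continuous_comp _ _ _ (fun z => z - k * expR z) (@expR R)); last exact: continuous_expR.
  apply: cvgB; first exact: cvg_id.
  by apply: cvgM; [exact: cvg_cst|exact: continuous_expR].
apply: (integral_exhaustion (@homo_natrN R) (@homo_natr R) (setT_bigcup_itv R)).
- by move=> t _; exact: expR_ge0.
- by move=> t _; exact: cf.
have -> : (fun n => sint (- n%:R) n%:R (fun z => expR (z - k * expR z))) =
   (fun n => k^-1 * (expR (- k * expR (- n%:R)) - expR (- k * expR n%:R))).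
  apply/funext => n; rewrite (sint_FTC (F := fun z => - k^-1 * expR (- k * expR z))) ?natr_symm//.
  - by ring.
have z1 := cvg_expRN (@ltr01 R); have zk := cvg_expRN k0.
rewrite [X in _ --> X](_ : _ = k^-1 * (1 - 0)); last by rewrite subr0 mulr1.
apply: cvgM; first exact: cvg_cst.
apply: cvgB.
- rewrite -[X in _ --> X]expR0.
  apply: (@continuous_cvg _ _ _ _ _ _ (@expR R)); first exact: continuous_expR.
  rewrite -[X in _ --> X](mulr0 (- k)); apply: cvgM; first exact: cvg_cst.
  by move: z1; under eq_fun do rewrite mul1r.
- apply: (squeeze_cvgr _ (cvg_cst 0) zk).
  apply: nearW => n; rewrite expR_ge0/= ler_expR mulNr lerN2 ler_pM2l//.
  by apply: le_trans (expR_ge1Dx _); rewrite lerDr.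
Qed.

(** Tonelli for exp (c y + z - e^z (1 + e^y)).  The integral over z is
    e^(c y) / (1 + e^y).  For fixed z the exponent is that of the product of
    the integrands of Gamma (1 - c) at z and of Gamma c at y + z. *)
Lemma cvg_beta c : 0 < c < 1 ->
  symm_int (beta_integrand c) n @[n --> \oo] --> Gamma c * Gamma (1 - c).
Proof.
move=> /andP[c0 c1]; have c1' : 0 < 1 - c by rewrite subr_gt0.
apply: (cvg_integral_exhaustion (@homo_natrN R) (@homo_natr R) (setT_bigcup_itv R)).
- by move=> t _; exact: beta_integrand_ge0.
- by move=> t _; exact: continuous_beta_integrand.
pose g (p : R * R) : R := expR (c * p.2 + p.1 - expR p.1 * (1 + expR p.2)).
have mg : measurable_fun [set: R * R] g.
  apply: measurableT_comp => //.
  apply: measurable_funB.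
    apply: measurable_funD => //.
    by apply: measurable_funM.
  apply: measurable_funM; first exact: measurableT_comp.
  by apply: measurable_funD => //; exact: measurableT_comp.
pose f := EFin \o g.
have f0 p : (0 <= f p)%E by rewrite lee_fin expR_ge0.
have E1 z : (\int[mu]_y f (z, y) = (log_gamma_integrand (1 - c) z * Gamma c)%:E)%E.
  rewrite EFinM -(integral_lgi_shift z c0) -ge0_integralZl_EFin//.
  - apply: eq_integral => y _; rewrite -EFinM /f /g /log_gamma_integrand -expRD/=.
    by congr (expR _)%:E; rewrite expRD; ring.
  - by move=> y _; rewrite lee_fin lgi_ge0.
  - apply/measurable_EFinP; apply: continuous_measurable_fun => t.
    apply: (@continuous_comp _ _ _ (fun y => y + z) (log_gamma_integrand c)).
      by apply: cvgD; [exact: cvg_id|exact: cvg_cst].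
    exact: continuous_lgi.
  - exact: lgi_ge0.
have E2 y : (\int[mu]_z f (z, y) = (beta_integrand c y)%:E)%E.
  have p0 : 0 < 1 + expR y by rewrite addr_gt0 ?expR_gt0.
  rewrite /beta_integrand EFinM -(integral_exp_exp p0) -ge0_integralZl_EFin//.
  - apply: eq_integral => z _; rewrite -EFinM /f /g -expRD/=.
    by congr (expR _)%:E; ring.
  - apply/measurable_EFinP; apply: measurableT_comp => //.
    apply: measurable_funB => //; apply: measurable_funM => //.
transitivity (\int[mu]_y \int[mu]_z f (z, y))%E.
  by apply: eq_integral => y _; rewrite E2.
rewrite -(@fubini_tonelli _ _ _ _ R mu mu f ((measurable_EFinP _ g).2 mg) f0).
transitivity (\int[mu]_z ((Gamma c)%:E * (log_gamma_integrand (1 - c) z)%:E))%E.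
  by apply: eq_integral => z _; rewrite E1 mulrC EFinM.
rewrite ge0_integralZl_EFin//.
- by rewrite integral_lgi.
- by move=> z _; rewrite lee_fin lgi_ge0.
- apply/measurable_EFinP; apply: continuous_measurable_fun; exact: continuous_lgi.
- by rewrite -lee_fin -(integral_lgi c0); apply: integral_ge0 => y _; rewrite lee_fin lgi_ge0.
Qed.

End Beta.

(** * Powers of s and integrals over arcs *)

Section Powers.
Set Implicit Arguments.
Unset Strict Implicit.
Variable R : realType.
Local Open Scope complex_scope.
Local Notation Re := complex.Re.
Local Notation Im := complex.Im.
Local Notation normc := (@Normc.normc R).
Notation D f x l := (is_derive (x : R) (1 : R) (f : R -> R) (l : R)).
Implicit Types (F G : R -> R -> R[i]) (f g phi : R -> R) (a b c k l y th al : R) (u v : nat -> R).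

Lemma normcE_sqr (z : R[i]) : normc z = Num.sqrt (Re z ^+ 2 + Im z ^+ 2).
Proof. by case: z. Qed.

Lemma norm_Re_le (z : R[i]) : `|Re z| <= normc z.
Proof. by rewrite normcE_sqr -sqrtr_sqr ler_wsqrtr// lerDl sqr_ge0. Qed.

Lemma norm_Im_le (z : R[i]) : `|Im z| <= normc z.
Proof. by rewrite normcE_sqr -sqrtr_sqr ler_wsqrtr// lerDr sqr_ge0. Qed.

Lemma normc_cexp (z : R[i]) : normc (cexp z) = expR (Re z).
Proof.
rewrite normcE_sqr /= !exprMn -mulrDr cos2Dsin2 mulr1 sqrtr_sqr ger0_norm//.
Qed.

Lemma normc_real a : normc a%:C = `|a|.
Proof. by rewrite /= expr0n addr0 sqrtr_sqr. Qed.

Lemma cexpD (z w : R[i]) : cexp (z + w) = cexp z * cexp w.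
Proof.
apply/eqP; rewrite eq_complex cReM cImM /= cReD cImD expRD sinD cosD.
by apply/andP; split; apply/eqP; ring.
Qed.

(** The sector theorem does not mention the derivative, so it is hidden. *)
Definition holomorphic al (F : R -> R -> R[i]) := exists F', holo al F F'.

Lemma holomorphicM al F G : holomorphic al F -> holomorphic al G ->
  holomorphic al (fun y th => F y th * G y th).
Proof. by move=> [F' hF] [G' hG]; exists (fun y th => F' y th * G y th + F y th * G' y th); exact: holoM. Qed.

Lemma holomorphicD al F G : holomorphic al F -> holomorphic al G ->
  holomorphic al (fun y th => F y th + G y th).
Proof. by move=> [F' hF] [G' hG]; exists (fun y th => F' y th + G' y th); exact: holoD. Qed.

Lemma holomorphic_cst al (c : R[i]) : holomorphic al (fun _ _ => c).
Proof. by exists (fun _ _ => 0); exact: holo_cst. Qed.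

Lemma holomorphicV al F : (forall y th, 0 <= th <= al -> F y th != 0) ->
  holomorphic al F -> holomorphic al (fun y th => (F y th)^-1).
Proof. by move=> F0 [F' hF]; eexists; exact: (holoV F0 hF). Qed.

Lemma holomorphic_exp al F : holomorphic al F -> holomorphic al (fun y th => cexp (F y th)).
Proof. by move=> [F' hF]; eexists; exact: (holo_exp hF). Qed.

(** The principal power s^b at s = exp (y + i th). *)
Definition spow b y th : R[i] := cexp ((b * y) +i* (b * th)).

Lemma holo_spow al b : holo al (spow b) (fun y th => b%:C * spow b y th).
Proof.
have e : spow b = fun y th => cexp (b%:C * (y +i* th)).
  apply/funext => y; apply/funext => th; congr cexp.
  by apply/eqP; rewrite eq_complex /=; apply/andP; split; apply/eqP; ring.
have := holo_exp (holoM (@holo_cst R al b%:C) (@holo_id _ al)).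
rewrite e; congr (holo _ _ _).
by apply/funext => y; apply/funext => th; rewrite mul0r add0r mulr1.
Qed.

Lemma holomorphic_spow al b : holomorphic al (spow b).
Proof. by eexists; exact: holo_spow. Qed.

Lemma normc_spow b y th : normc (spow b y th) = expR (b * y).
Proof. by rewrite normc_cexp. Qed.

Lemma spowD b c y th : spow (b + c) y th = spow b y th * spow c y th.
Proof.
rewrite /spow -cexpD; congr cexp.
by apply/eqP; rewrite eq_complex /=; apply/andP; split; apply/eqP; ring.
Qed.

Lemma spow0 y th : spow 0 y th = 1.
Proof.
by apply/eqP; rewrite eq_complex /= !mul0r expR0 cos0 sin0 !mul1r !eqxx.
Qed.

(** The integral of Re F along the arc of radius e^y with respect to the angle. *)
Definition arc_int al (F : R -> R -> R[i]) y : R := sint 0 al (fun th => Re (F y th)).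

Lemma holomorphic_Re al F y : holomorphic al F ->
  {in `[0, al], continuous (fun th => Re (F y th) : R)}.
Proof. by move=> [F' hF]; exact: (holo_continuous_ReF hF). Qed.

Lemma arc_int_sub al F y1 y2 : 0 <= al -> y1 <= y2 -> holomorphic al F ->
  arc_int al F y2 - arc_int al F y1 = sint y1 y2 (fun y => Im (F y al) - Im (F y 0)).
Proof. by move=> al0 y12 [F' hF]; exact: (sector_theorem al0 hF). Qed.

Lemma holomorphic_Im al F th : holomorphic al F -> th \in `[0, al] ->
  continuous (fun y => Im (F y th) : R).
Proof. by move=> [F' hF]; exact: (holo_continuous_ImFy hF). Qed.

Lemma arc_int_le al F y M : 0 <= al -> holomorphic al F ->
  (forall th, th \in `[0, al] -> normc (F y th) <= M) -> `|arc_int al F y| <= M * al.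
Proof.
move=> al0 hF hM; rewrite -[X in _ <= _ * X]subr0; apply: sint_norm_le => //.
- exact: holomorphic_Re.
- by move=> th /hM; apply: le_trans; exact: norm_Re_le.
Qed.

Lemma arc_intD al F G y : holomorphic al F -> holomorphic al G ->
  arc_int al (fun y th => F y th + G y th) y = arc_int al F y + arc_int al G y.
Proof.
move=> hF hG; rewrite /arc_int -sintD; [|exact: holomorphic_Re|exact: holomorphic_Re].
by apply: eq_sint => th _; rewrite cReD.
Qed.

Lemma arc_int_cst al (z : R[i]) y : 0 <= al -> arc_int al (fun _ _ => z) y = Re z * al.
Proof. by move=> al0; rewrite /arc_int sint_cst ?subr0. Qed.

(** The index 0 is left out because the bounds on 1 / (1 + s) below fail on the
    unit circle. *)
Lemma arc_int_cvg al F (z : R[i]) (y_ eps : nat -> R) : 0 <= al -> holomorphic al F ->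
  (forall n th, (0 < n)%N -> th \in `[0, al] -> normc (F (y_ n) th - z) <= eps n) ->
  eps n @[n --> \oo] --> (0 : R) ->
  arc_int al F (y_ n) @[n --> \oo] --> Re z * al.
Proof.
move=> al0 hF h e0.
apply/subr_cvg0; apply: norm_cvg0.
have E n : arc_int al F (y_ n) - Re z * al = arc_int al (fun y th => F y th + - z) (y_ n).
  rewrite arc_intD//; last exact: holomorphic_cst.
  by rewrite arc_int_cst//; case: z {h} => ? ?/=; rewrite mulNr.
have e1 : eps n * al @[n --> \oo] --> (0 : R).
  by rewrite -(mul0r al); apply: cvgM => //; exact: cvg_cst.
apply: (squeeze_cvgr _ (cvg_cst 0) e1).
exists 1%N => // n /= n0; rewrite normr_ge0 E/=.
apply: arc_int_le => //; last by move=> th; exact: h.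
by apply: holomorphicD => //; exact: holomorphic_cst.
Qed.

End Powers.

(** * A sector around the Beta integral *)

Section SectorKernel.
Set Implicit Arguments.
Unset Strict Implicit.
Variable R : realType.
Local Open Scope complex_scope.
Local Notation Re := complex.Re.
Local Notation Im := complex.Im.
Local Notation normc := (@Normc.normc R).
Notation D f x l := (is_derive (x : R) (1 : R) (f : R -> R) (l : R)).
Implicit Types (F G : R -> R -> R[i]) (f g phi : R -> R) (a b c k l y th al : R) (u v : nat -> R).

Lemma normc_triangle (z w : R[i]) : normc z <= normc w + normc (z - w).
Proof.
have := le_normcD (w : Rcomplex R) (z - w : Rcomplex R).
by rewrite addrC subrK.
Qed.

Lemma normc_opp (z : R[i]) : normc (- z) = normc z.
Proof. exact: normcN. Qed.

Lemma normc_1D_spow y th : `|expR y - 1| <= normc (1 + spow 1 y th).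
Proof.
have n1 : normc (spow 1 y th) = expR y by rewrite normc_spow mul1r.
have h1 := normc_triangle (spow 1 y th) (1 + spow 1 y th).
have h2 := normc_triangle 1 (1 + spow 1 y th).
have e1 : spow 1 y th - (1 + spow 1 y th) = - 1 by ring.
have e2 : 1 - (1 + spow 1 y th) = - spow 1 y th by ring.
rewrite e1 normc_opp Normc.normc1 n1 in h1.
rewrite e2 normc_opp Normc.normc1 n1 in h2.
by rewrite ler_norml; apply/andP; split; lra.
Qed.

Lemma spow1_neqN1 al y th : al < pi -> 0 <= th <= al -> 1 + spow 1 y th != 0.
Proof.
move=> alpi /andP[th0 thal]; rewrite eq_complex /= !mul1r negb_and add0r.
move: th0; rewrite le_eqVlt => /predU1P[<-|th0].
  by rewrite cos0 mulr1 gt_eqF// addr_gt0 ?expR_gt0.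
by rewrite orbC gt_eqF// mulr_gt0 ?expR_gt0// sin_gt0_pi// th0 (le_lt_trans thal).
Qed.

(** The factor e^(- i c al) cancels the argument of s^c on the upper edge of the
    sector, where only the imaginary part of 1 / (1 + s) is left. *)
Definition beta_sector c al y th : R[i] :=
  cexp (0 +i* (- (c * al))) * (spow c y th * (1 + spow 1 y th)^-1).

Lemma holomorphic_beta_sector c al : al < pi -> holomorphic al (beta_sector c al).
Proof.
move=> alpi; apply: holomorphicM; first exact: holomorphic_cst.
apply: holomorphicM; first exact: holomorphic_spow.
apply: holomorphicV; first by move=> y th; exact: spow1_neqN1.
by apply: holomorphicD; [exact: holomorphic_cst|exact: holomorphic_spow].
Qed.

(** Minus the imaginary part of 1 / (1 + e^y e^(i al)).  As al tends to pi it
    concentrates at y = 0. *)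
Definition sector_kernel al y : R :=
  expR y * sin al / ((1 + expR y * cos al) ^+ 2 + (expR y * sin al) ^+ 2).

Lemma sector_kernel_ge0 al y : 0 <= al <= pi -> 0 <= sector_kernel al y.
Proof.
by move=> h; rewrite divr_ge0 ?addr_ge0 ?sqr_ge0// mulr_ge0 ?expR_ge0// sin_ge0_pi.
Qed.

Lemma Im_beta_sector_al c al y :
  Im (beta_sector c al y al) = - (expR (c * y) * sector_kernel al y).
Proof.
rewrite /beta_sector mulrA -cexpD.
have -> : (0 +i* (- (c * al)) + (c * y +i* (c * al)) : R[i]) = (c * y)%:C.
  by apply/eqP; rewrite eq_complex /= add0r addNr !eqxx.
rewrite cImM /= sin0 cos0 mulr0 mul0r addr0 mulr1 !mul1r /sector_kernel.
by rewrite add0r mulrN.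
Qed.

Lemma Im_beta_sector_0 c al y :
  Im (beta_sector c al y 0) = - (sin (c * al) * beta_integrand c y).
Proof.
rewrite /beta_sector.
have -> : spow 1 y 0 = (expR y)%:C.
  by apply/eqP; rewrite eq_complex /= !mul1r sin0 cos0 mulr0 mulr1 !eqxx.
have e : spow c y 0 = (expR (c * y))%:C.
  by apply/eqP; rewrite eq_complex /= mulr0 sin0 cos0 mulr0 mulr1 !eqxx.
have p0 : 1 + expR y != 0 by rewrite gt_eqF// addr_gt0 ?expR_gt0.
have -> : ((1 + (expR y)%:C)^-1 : R[i]) = ((1 + expR y)^-1)%:C.
  rewrite -[1]/(1%:C) -(rmorphD (real_complex R)) fmorphV//.
rewrite e -(rmorphM (real_complex R)) cImM /= expR0 sinN /beta_integrand.
by ring.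
Qed.

(** The sector theorem for beta_sector: the upper edge contributes the kernel,
    the lower edge the Beta integrand. *)
Lemma arc_beta_sector c al n : 0 <= al < pi ->
  symm_int (fun y => expR (c * y) * sector_kernel al y) n =
  sin (c * al) * symm_int (beta_integrand c) n
   - (arc_int al (beta_sector c al) n%:R - arc_int al (beta_sector c al) (- n%:R)).
Proof.
move=> /andP[al0 alpi]; have hG := holomorphic_beta_sector c alpi.
rewrite arc_int_sub// ?natr_symm//.
have c1 : continuous (fun y => Im (beta_sector c al y al) : R).
  by apply: (holomorphic_Im hG); rewrite in_itv/= lexx al0.
have c2 : continuous (fun y => - Im (beta_sector c al y 0) : R).
  move=> y; apply: cvgN.
  by apply: (holomorphic_Im hG); rewrite in_itv/= lexx al0.
rewrite sintD; [|by move=> y _; exact: c1|by move=> y _; exact: c2].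
rewrite -sintZ; last by move=> y _; exact: continuous_beta_integrand.
rewrite (eq_sint (g := fun y => sin (c * al) * beta_integrand c y) (f := fun y => - Im (beta_sector c al y 0))); last first.
  by move=> y _; rewrite Im_beta_sector_0 opprK.
rewrite opprD addrCA subrr addr0 -[RHS]mulN1r -sintZ; last by move=> y _; exact: c1.
by apply: eq_sint => y _; rewrite Im_beta_sector_al mulN1r opprK.
Qed.

Lemma continuous_kernel_mul c al : 0 <= al < pi ->
  continuous (fun y => expR (c * y) * sector_kernel al y : R).
Proof.
move=> /andP[al0 alpi]; have hG := holomorphic_beta_sector c alpi.
have -> : (fun y => expR (c * y) * sector_kernel al y : R) = fun y => - Im (beta_sector c al y al).
  by apply/funext => y; rewrite Im_beta_sector_al opprK.
move=> y; apply: cvgN.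
by apply: (holomorphic_Im hG); rewrite in_itv/= lexx al0.
Qed.

Lemma normc_beta_sector c al y th :
  normc (beta_sector c al y th) = expR (c * y) / normc (1 + spow 1 y th).
Proof.
rewrite /beta_sector !Normc.normcM normc_cexp Normc.normcV normc_spow.
by rewrite (_ : expR (Re _) = 1) ?mul1r// -[RHS]expR0.
Qed.

Lemma expR_nat_ge2 (n : nat) : (0 < n)%N -> 2 <= expR (n%:R) :> R.
Proof.
move=> n0; apply: le_trans (expR_ge1Dx _).
by rewrite -[2]/(1 + 1) lerD2l ler1n.
Qed.

Lemma normc_1D_spow_nat (n : nat) th : (0 < n)%N ->
  2^-1 * expR n%:R <= normc (1 + spow 1 n%:R th).
Proof.
move=> n0; apply: le_trans (normc_1D_spow _ _); apply: le_trans (ler_norm _).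
have := expR_nat_ge2 n0; lra.
Qed.

Lemma normc_1D_spow_natN (n : nat) th : (0 < n)%N ->
  2^-1 <= normc (1 + spow 1 (- n%:R) th).
Proof.
move=> n0; apply: le_trans (normc_1D_spow _ _); rewrite distrC.
apply: le_trans (ler_norm _).
have h : expR (- n%:R : R) <= 2^-1.
  by rewrite expRN lef_pV2 ?posrE ?expR_gt0// expR_nat_ge2.
by lra.
Qed.

Lemma arc_beta_sector_cvgy c al : 0 <= al < pi -> c < 1 ->
  arc_int al (beta_sector c al) n%:R @[n --> \oo] --> (0 : R).
Proof.
move=> /andP[al0 alpi] c1; have hG := holomorphic_beta_sector c alpi.
rewrite -(mul0r al) -[X in X * al]/(Re (0 : R[i])).
apply: (arc_int_cvg (eps := fun n => 2 * expR (- ((1 - c) * n%:R)))) => //.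
- move=> n th n0 _; rewrite subr0 normc_beta_sector.
  have p := lt_le_trans _ (normc_1D_spow_nat th n0).
  rewrite ler_pdivrMr ?p ?mulr_gt0 ?expR_gt0//.
  apply: le_trans (ler_wpM2l _ (normc_1D_spow_nat th n0)); last by rewrite mulr_ge0 ?expR_ge0.
  rewrite mulrACA divff ?mul1r// -expRD ler_expR; lra.
- rewrite -(mulr0 2); apply: cvgM; first exact: cvg_cst.
  by apply: cvg_expRN; rewrite subr_gt0.
Qed.

Lemma arc_beta_sector_cvgNy c al : 0 <= al < pi -> 0 < c ->
  arc_int al (beta_sector c al) (- n%:R) @[n --> \oo] --> (0 : R).
Proof.
move=> /andP[al0 alpi] c0; have hG := holomorphic_beta_sector c alpi.
rewrite -(mul0r al) -[X in X * al]/(Re (0 : R[i])).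
apply: (arc_int_cvg (eps := fun n => 2 * expR (- (c * n%:R)))) => //.
- move=> n th n0 _; rewrite subr0 normc_beta_sector.
  have p := lt_le_trans _ (normc_1D_spow_natN th n0).
  rewrite ler_pdivrMr ?p// mulrN.
  apply: le_trans (ler_wpM2l _ (normc_1D_spow_natN th n0)); last by rewrite mulr_ge0 ?expR_ge0.
  by rewrite mulrAC divff ?mul1r.
- rewrite -(mulr0 2); apply: cvgM; first exact: cvg_cst.
  exact: cvg_expRN.
Qed.

(** For c = 0 the integrand tends to 1 at the origin, whence the mass al of the
    kernel. *)
Lemma arc_beta_sector0_cvgNy al : 0 <= al < pi ->
  arc_int al (beta_sector 0 al) (- n%:R) @[n --> \oo] --> (al : R).
Proof.
move=> /andP[al0 alpi]; have hG := holomorphic_beta_sector 0 alpi.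
rewrite -[X in _ --> X](mul1r al) -[X in X * al]/(Re (1 : R[i])).
apply: (arc_int_cvg (eps := fun n => 2 * expR (- (1 * n%:R)))) => //.
- move=> n th n0 thal.
  have s0 := @spow1_neqN1 al (- n%:R) th alpi thal.
  have -> : beta_sector 0 al (- n%:R) th - 1 = - (spow 1 (- n%:R) th / (1 + spow 1 (- n%:R) th)).
    have -> : beta_sector 0 al (- n%:R) th = (1 + spow 1 (- n%:R) th)^-1.
      rewrite /beta_sector mul0r oppr0 spow0 mul1r.
      by rewrite (_ : cexp _ = 1) ?mul1r//; apply/eqP; rewrite eq_complex /= expR0 cos0 sin0 mul1r mulr0 !eqxx.
    by field.
  rewrite normc_opp Normc.normcM Normc.normcV normc_spow.
  have p := lt_le_trans _ (normc_1D_spow_natN th n0).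
  rewrite ler_pdivrMr ?p// mulrN.
  apply: le_trans (ler_wpM2l _ (normc_1D_spow_natN th n0)); last by rewrite mulr_ge0 ?expR_ge0.
  by rewrite mulrAC divff ?mul1r.
- rewrite -(mulr0 2); apply: cvgM; first exact: cvg_cst.
  exact: cvg_expRN.
Qed.

Lemma cvg_kernel c al : 0 <= al < pi -> 0 < c < 1 ->
  symm_int (fun y => expR (c * y) * sector_kernel al y) n @[n --> \oo] -->
  sin (c * al) * (Gamma c * Gamma (1 - c)).
Proof.
move=> hal hc; have /andP[c0 c1] := hc.
have -> : symm_int (fun y => expR (c * y) * sector_kernel al y) =
    fun n => sin (c * al) * symm_int (beta_integrand c) n
   - (arc_int al (beta_sector c al) n%:R - arc_int al (beta_sector c al) (- n%:R)).
  by apply/funext => n; rewrite arc_beta_sector.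
rewrite -[X in _ --> X]subr0; apply: cvgB.
  by apply: cvgM; [exact: cvg_cst|exact: cvg_beta].
rewrite -(subr0 0); apply: cvgB.
  exact: arc_beta_sector_cvgy.
exact: arc_beta_sector_cvgNy.
Qed.

Lemma cvg_kernel0 al : 0 <= al < pi ->
  symm_int (sector_kernel al) n @[n --> \oo] --> (al : R).
Proof.
move=> hal.
have -> : symm_int (sector_kernel al) = symm_int (fun y => expR (0 * y) * sector_kernel al y).
  by congr symm_int; apply/funext => y; rewrite mul0r expR0 mul1r.
have -> : symm_int (fun y => expR (0 * y) * sector_kernel al y) =
    fun n => - (arc_int al (beta_sector 0 al) n%:R - arc_int al (beta_sector 0 al) (- n%:R)).
  by apply/funext => n; rewrite arc_beta_sector// mul0r sin0 mul0r add0r.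
rewrite -[X in _ --> X]opprK; apply: cvgN; rewrite -sub0r; apply: cvgB.
  by apply: arc_beta_sector_cvgy.
exact: arc_beta_sector0_cvgNy.
Qed.

(** Convexity between 0 and y, as the mean of two tangent inequalities at k y. *)
Lemma expR_chord k y : 0 <= k <= 1 -> expR (k * y) <= (1 - k) + k * expR y.
Proof.
move=> /andP[k0 k1].
have h1 := expR_ge1Dx ((1 - k) * y).
have h2 := expR_ge1Dx (- (k * y)).
have e1 : expR y = expR (k * y) * expR ((1 - k) * y) by rewrite -expRD; congr expR; ring.
have e2 : 1 = expR (k * y) * expR (- (k * y)) :> R by rewrite -expRD subrr expR0.
have p := expR_ge0 (k * y).
rewrite {1}e2 e1.
have : k * (expR (k * y) * (1 + (1 - k) * y)) <= k * (expR (k * y) * expR ((1 - k) * y)).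
  by rewrite ler_wpM2l// ler_wpM2l.
have : (1 - k) * (expR (k * y) * (1 + - (k * y))) <= (1 - k) * (expR (k * y) * expR (- (k * y))).
  by rewrite ler_wpM2l ?subr_ge0// ler_wpM2l.
rewrite -e2 mulr1; set E := expR (k * y); set X := expR _.
move=> A B; nra.
Qed.

End SectorKernel.

(** * The reflection formula *)

Section Reflection.
Set Implicit Arguments.
Unset Strict Implicit.
Variable R : realType.
Notation D f x l := (is_derive (x : R) (1 : R) (f : R -> R) (l : R)).
Implicit Types (a b c k l y th al : R).

(** The Beta integral of c and 1 - c, by cvg_beta. *)
Let A c : R := Gamma c * Gamma (1 - c).

(** The chord inequality integrated against the kernel, whose mass is al and
    whose integral against e^(c y) is sin (c al) A(c). *)
Let beta_convex_al k c al : 0 < k <= 1 -> 0 < c < 1 -> 0 <= al < pi ->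
  sin (k * c * al) * A (k * c) <= (1 - k) * al + k * (sin (c * al) * A c).
Proof.
move=> /andP[k0 k1] /andP[c0 c1] hal.
have hkc : 0 < k * c < 1.
  by rewrite mulr_gt0//= (le_lt_trans _ c1)// ler_piMl// ltW.
have h1 := cvg_kernel hal hkc.
have h2 : (1 - k) * symm_int (sector_kernel al) n +
   k * symm_int (fun y => expR (c * y) * sector_kernel al y) n @[n --> \oo] -->
   (1 - k) * al + k * (sin (c * al) * A c).
  apply: cvgD; apply: cvgM; try exact: cvg_cst.
  - exact: cvg_kernel0.
  - by apply: cvg_kernel => //; rewrite c0.
apply: (ler_cvg_to h1 h2); apply: nearW => n.
have c2 := @continuous_kernel_mul _ c al hal.
have c3 := @continuous_kernel_mul _ (k * c) al hal.
have c4 : continuous (sector_kernel al).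
  move=> y; have := @continuous_kernel_mul _ 0 al hal y.
  by under eq_fun do rewrite mul0r expR0 mul1r.
rewrite /symm_int -!sintZ; [|by move=> y _; exact: c4|by move=> y _; exact: c2].
have c5 (j : R) (f : R -> R) : continuous f -> continuous (fun y : R => j * f y : R).
  by move=> cf y; apply: cvgM; [exact: cvg_cst|exact: cf].
rewrite -sintD; [|by move=> y _; exact: c5|by move=> y _; exact: (c5 _ _ c2)].
apply: le_sint.
- by move=> y _; exact: c3.
- by move=> y _; apply: cvgD; [exact: c5|exact: (c5 _ _ c2)].
- move=> y _; rewrite mulrA -mulrDl; apply: ler_wpM2r.
    by apply: sector_kernel_ge0; case/andP: hal => -> /ltW ->.
  by rewrite -mulrA; apply: expR_chord; rewrite (ltW k0).
Qed.

(** The limit of the preceding inequality as al tends to pi: the sector theorem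
    itself is not available at al = pi, where the pole of 1 / (1 + s) is on the
    edge. *)
Let beta_convex k c : 0 < k <= 1 -> 0 < c < 1 ->
  sin (k * c * pi) * A (k * c) <= (1 - k) * pi + k * (sin (c * pi) * A c).
Proof.
move=> hk hc; rewrite -subr_ge0.
pose h al : R := (1 - k) * al + k * (sin (c * al) * A c) - sin (k * c * al) * A (k * c).
have ch : {for pi, continuous h}.
  apply: (@is_derive_continuous _ _ _
    ((1 - k) + k * (cos (c * pi) * c * A c) - cos (k * c * pi) * (k * c) * A (k * c))).
  have d1 := derive_mull (1 - k) (pi : R).
  have d2 := derive_sin_comp (derive_mull c (pi : R)).
  have d3 := derive_sin_comp (derive_mull (k * c) (pi : R)).
  have d4 := deriveM_real d2 (is_derive_cst (A c) (pi : R) (1 : R)).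
  have d5 := deriveM_real d3 (is_derive_cst (A (k * c)) (pi : R) (1 : R)).
  have d6 := deriveM_real (is_derive_cst k (pi : R) (1 : R)) d4.
  apply: (is_derive_eq (is_deriveB (is_deriveD d1 d6) d5)).
  by rewrite /=; ring.
apply: (cvgr_to_ge (cvg_at_left_filter ch)).
near=> al; rewrite subr_ge0; apply: beta_convex_al => //.
by apply/andP; split; near: al; [apply: nbhs_left_ge; exact: pi_gt0|exact: nbhs_left_lt].
Unshelve. all: by end_near. Qed.

(** The primitive of the integrand is twice the arctangent of e^(y / 2). *)
Let beta_half : A 2^-1 = pi.
Proof.
have h2 : 0 < (2^-1 : R) < 1 by rewrite invr_gt0 ltr0n /= invf_lt1// ltr1n.
suff h : symm_int (beta_integrand (2^-1 : R)) n @[n --> \oo] --> (pi : R).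
  exact: (cvg_unique (@norm_hausdorff _ _) (cvg_beta h2) h).
have dF y : D (fun y => 2 * atan (expR (2^-1 * y))) y (beta_integrand 2^-1 y).
  have d := @is_derive1_comp _ atan (fun y => expR (2^-1 * y)) _ _ _
     (is_derive1_atan _) (derive_expR_comp (derive_mull (2^-1 : R) y)).
  apply: (is_derive_eq (deriveM_real (is_derive_cst (2 : R) y (1 : R)) d)).
  have e : expR y = expR (2^-1 * y) ^+ 2 by rewrite -expRM_natr; congr expR; field.
  rewrite mul0r add0r /= /beta_integrand e; field.
  by rewrite gt_eqF// ltr_wpDr ?sqr_ge0.
have -> : symm_int (beta_integrand (2^-1 : R)) =
    fun n : nat => 2 * atan (expR (2^-1 * n%:R)) - 2 * atan (expR (2^-1 * - n%:R)).
  apply/funext => n; apply: (sint_FTC (F := fun y => 2 * atan (expR (2^-1 * y)))).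
  - exact: natr_symm.
  - by move=> t _; exact: continuous_beta_integrand.
  - by move=> t _; exact: dF.
rewrite (_ : pi = 2 * (pi / 2) - 2 * 0); last by field.
apply: cvgB; (apply: cvgM; first exact: cvg_cst).
- apply: (cvg_comp _ _ _ (@cvgy_atan R)).
  apply/cvgryPge => M.
  have [N _ hN] := nbhs_infty_ger (2 * M).
  exists N => // n Nn; have := hN n Nn; have := expR_ge1Dx (2^-1 * n%:R : R) => /=; lra.
- rewrite -(atan0 R).
  apply: (@continuous_cvg _ _ _ _ _ _ (@atan R)); first exact: continuous_atan.
  have := @cvg_expRN R 2^-1; rewrite invr_gt0 ltr0n => /(_ isT).
  by under eq_fun do rewrite -mulrN.
Qed.

(** With phi c = sin (c pi) A(c), the inequality beta_convex for the pair
    (c, 1/2) gives phi c <= pi when c <= 1/2, and for the pair (1/2, c) it gives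
    phi c >= pi when c >= 1/2.  The symmetry of phi exchanges the two halves. *)
Lemma gamma_reflection c : 0 < c < 1 -> Gamma c * Gamma (1 - c) * sin (pi * c) = pi.
Proof.
move=> hc; pose phi c := sin (c * pi) * A c.
have phi2 : phi 2^-1 = pi by rewrite /phi mulrC beta_half (mulrC 2^-1) sin_pihalf mulr1.
have phiC b : phi (1 - b) = phi b.
  rewrite /phi /A subKr (mulrC (Gamma (1 - b))); congr (_ * _).
  by rewrite mulrBl mul1r addrC sinDpi sinN opprK.
have h2 : 0 < (2^-1 : R) < 1 by rewrite invr_gt0 ltr0n /= invf_lt1// ltr1n.
have le b : 0 < b <= 2^-1 -> phi b <= pi.
  move=> /andP[b0 b2].
  have hk : 0 < 2 * b <= 1 by lra.
  have := beta_convex hk h2; rewrite -/(phi 2^-1) phi2.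
  rewrite (_ : 2 * b * 2^-1 = b) -/(phi b); last by field.
  by move=> h; apply: (le_trans h); lra.
have ge b : 2^-1 <= b < 1 -> pi <= phi b.
  move=> /andP[b2 b1]; have b0 : 0 < b by lra.
  have hk : 0 < (2 * b)^-1 <= 1.
    rewrite invr_gt0 mulr_gt0//= invf_le1 ?mulr_gt0//; lra.
  have hb : 0 < b < 1 by rewrite b0.
  have := beta_convex hk hb; rewrite -/(phi b).
  rewrite (_ : (2 * b)^-1 * b = 2^-1) -/(phi 2^-1) ?phi2; last by field; rewrite gt_eqF.
  rewrite mulrBl mul1r -addrA lerDl addrC subr_ge0 ler_pM2l//.
  by case/andP: hk.
suff E : phi c = pi by rewrite -[RHS]E /phi /A mulrC (mulrC c).
move: hc => /andP[c0 c1].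
apply: le_anti; apply/andP; split.
- have [h|h] := leP c 2^-1; first by apply: le; rewrite c0.
  by rewrite -phiC; apply: le; apply/andP; split; lra.
- have [h|h] := leP 2^-1 c; first by apply: ge; rewrite h.
  by rewrite -phiC; apply: ge; apply/andP; split; lra.
Qed.

End Reflection.

(** * Hankel integrals for the reciprocal of Gamma *)

Section Hankel.
Set Implicit Arguments.
Unset Strict Implicit.
Variable R : realType.
Local Open Scope complex_scope.
Local Notation Re := complex.Re.
Local Notation Im := complex.Im.
Local Notation normc := (@Normc.normc R).
Notation D f x l := (is_derive (x : R) (1 : R) (f : R -> R) (l : R)).
Implicit Types (a b c k l y th al : R) (n m : nat).

(** The integrand e^s s^(-b) of the Hankel integral, taken with respect to
    ds/s = i dth on arcs. *)
Definition hankel b y th : R[i] := cexp (spow 1 y th) * spow (- b) y th.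

Let pi0 : 0 <= pi :> R. Proof. exact: pi_ge0. Qed.

Lemma holomorphic_exp_spow1 al : holomorphic al (fun y th => cexp (spow 1 y th : R[i])).
Proof. by apply: holomorphic_exp; exact: holomorphic_spow. Qed.

Lemma holomorphic_hankel al b : holomorphic al (hankel b).
Proof. by apply: holomorphicM; [exact: holomorphic_exp_spow1|exact: holomorphic_spow]. Qed.

Lemma spow1_pi y : spow 1 y pi = (- expR y)%:C.
Proof. by apply/eqP; rewrite eq_complex /= !mul1r cospi sinpi mulr0 mulrN1 !eqxx. Qed.

Lemma spow_th0 b y : spow b y 0 = (expR (b * y))%:C.
Proof. by apply/eqP; rewrite eq_complex /= mulr0 cos0 sin0 mulr1 mulr0 !eqxx. Qed.

Lemma cexp_real b : cexp b%:C = (expR b)%:C.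
Proof. by apply/eqP; rewrite eq_complex /= cos0 sin0 mulr1 mulr0 !eqxx. Qed.

Lemma normc_exp_spow1 y th : normc (cexp (spow 1 y th)) <= expR (expR y).
Proof.
rewrite normc_cexp ler_expR /= !mul1r -[leRHS]mulr1 ler_pM2l ?expR_gt0//.
Qed.

Lemma normc_hankel b y th : normc (hankel b y th) <= expR (expR y) * expR (- b * y).
Proof.
rewrite Normc.normcM normc_spow ler_wpM2r ?expR_ge0//; exact: normc_exp_spow1.
Qed.

Lemma Im_hankel_pi b y : Im (hankel b y pi) = sin (- b * pi) * log_gamma_integrand (- b) y.
Proof.
rewrite /hankel spow1_pi cexp_real cImM /= mul0r addr0 /log_gamma_integrand expRD.
by ring.
Qed.

Lemma Im_hankel_0 b y : Im (hankel b y 0) = 0.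
Proof. by rewrite /hankel !spow_th0 cexp_real cImM /= mulr0 mul0r addr0. Qed.

Lemma arc_hankel_symm b n :
  arc_int pi (hankel b) n%:R = arc_int pi (hankel b) (- n%:R) +
   sin (- b * pi) * symm_int (log_gamma_integrand (- b)) n.
Proof.
apply/eqP; rewrite addrC -subr_eq arc_int_sub ?natr_symm//; last exact: holomorphic_hankel.
apply/eqP; rewrite /symm_int -sintZ; last by move=> t _; exact: continuous_lgi.
by apply: eq_sint => y _; rewrite Im_hankel_pi Im_hankel_0 subr0.
Qed.

(** For b < 0 the arcs around the origin vanish in the limit, and what remains
    is the integral along the negative axis, that is Gamma (- b). *)
Lemma cvg_hankel_neg b : -1 < b < 0 ->
  arc_int pi (hankel b) n%:R @[n --> \oo] --> (pi / Gamma (1 + b) : R).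
Proof.
move=> /andP[b1 b0]; have b0' : 0 < - b by rewrite oppr_gt0.
have h := @gamma_reflection R (- b); rewrite opprK in h.
have {}h : Gamma (- b) * Gamma (1 + b) * sin (pi * - b) = pi.
  by apply: h; apply/andP; split; lra.
have G0 : Gamma (1 + b) != 0.
  by apply: contra_eq_neq h => ->; rewrite mulr0 mul0r eq_sym gt_eqF// pi_gt0.
have -> : pi / Gamma (1 + b) = 0 + sin (- b * pi) * Gamma (- b).
  by rewrite -{1}h add0r (mulrC (- b) pi); field.
have -> : (fun n => arc_int pi (hankel b) n%:R) = fun n => arc_int pi (hankel b) (- n%:R) +
   sin (- b * pi) * symm_int (log_gamma_integrand (- b)) n.
  by apply/funext => n; rewrite arc_hankel_symm.
apply: cvgD; last by apply: cvgM; [exact: cvg_cst|exact: cvg_gamma].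
rewrite -(mul0r pi) -[X in X * pi]/(Re (0 : R[i])).
apply: (arc_int_cvg (eps := fun n => expR 1 * expR (- (- b * n%:R)))) => //.
- exact: holomorphic_hankel.
- move=> n th _ _; rewrite subr0; apply: le_trans (normc_hankel _ _ _) _.
  rewrite mulrN ler_wpM2r ?expR_ge0// ler_expR -[leRHS]expR0 ler_expR.
  by rewrite oppr_le0.
- rewrite -(mulr0 (expR 1)); apply: cvgM; first exact: cvg_cst.
  exact: cvg_expRN.
Qed.

(** For b = 0 the integrand is real on both edges, so that the arc does not
    depend on its radius; near the origin e^s tends to 1. *)
Lemma cvg_hankel0 : arc_int pi (hankel 0) n%:R @[n --> \oo] --> (pi / Gamma (1 + 0) : R).
Proof.
rewrite addr0 gamma1 divr1.
have -> : (fun n => arc_int pi (hankel 0) n%:R) = fun n => arc_int pi (hankel 0) (- n%:R).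
  by apply/funext => n; rewrite arc_hankel_symm oppr0 mul0r sin0 mul0r addr0.
have r0 : expR (- n%:R) @[n --> \oo] --> (0 : R).
  have := @cvg_expRN R 1 ltr01; by under eq_fun do rewrite mul1r.
have ReE r th : Re (hankel 0 r th) = expR (expR r * cos th) * cos (expR r * sin th).
  by rewrite /hankel oppr0 spow0 mulr1 /= !mul1r.
have cR n : {in `[0, pi], continuous (fun th => Re (hankel 0 (- n%:R) th) : R)}.
  by apply: holomorphic_Re; exact: holomorphic_hankel.
have cst_c (k : R) : {in `[(0 : R), pi], continuous (fun=> k)}.
  by move=> t _; exact: cst_continuous.
(* With r = e^(-n) <= 1: exp (-r) cos r <= Re e^s <= exp r on the circle. *)
have lo : expR (- expR (- n%:R)) * cos (expR (- n%:R)) * pi @[n --> \oo] --> (pi : R).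
  rewrite -[X in _ --> X]mul1r; apply: cvgM; last exact: cvg_cst.
  rewrite -[X in _ --> X]mulr1; apply: cvgM.
    rewrite -[X in _ --> X]expR0 -oppr0.
    by apply: (@continuous_cvg _ _ _ _ _ _ (@expR R)); [exact: continuous_expR|exact: cvgN].
  rewrite -[X in _ --> X]cos0.
  by apply: (@continuous_cvg _ _ _ _ _ _ (@cos R)); first exact: continuous_cos.
have hi : expR (expR (- n%:R)) * pi @[n --> \oo] --> (pi : R).
  rewrite -[X in _ --> X]mul1r; apply: cvgM; last exact: cvg_cst.
  rewrite -[X in _ --> X]expR0.
  by apply: (@continuous_cvg _ _ _ _ _ _ (@expR R)); first exact: continuous_expR.
apply: (squeeze_cvgr _ lo hi); apply: nearW => n.
rewrite -{1 4}(subr0 pi) -!sint_cst//.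
have rp := expR_ge0 (- n%:R : R).
have r1 : expR (- n%:R : R) <= 1 by rewrite -[leRHS]expR0 ler_expR oppr_le0.
have pi1 : 1 <= pi :> R by apply: le_trans (pi_ge2 R); rewrite ler1n.
rewrite /arc_int; apply/andP; split;
  (apply: le_sint; [first [exact: cst_c|exact: cR]|first [exact: cst_c|exact: cR]|]).
- move=> th; rewrite in_itv/= => /andP[th0 thpi]; rewrite [leRHS](ReE (- n%:R) th).
  have s0 : 0 <= sin th by apply: sin_ge0_pi; rewrite th0.
  have c1 : cos (expR (- n%:R)) <= cos (expR (- n%:R) * sin th).
    have : expR (- n%:R) * sin th <= expR (- n%:R).
      by rewrite -[leRHS]mulr1 ler_wpM2l// sin_le1.
    rewrite le_eqVlt => /predU1P[->//|lt_r]; apply: ltW.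
    have h1 : expR (- n%:R) \in `[(0 : R), pi] by rewrite in_itv/=; apply/andP; split=> //; exact: le_trans r1 pi1.
    have h2 : expR (- n%:R) * sin th \in `[(0 : R), pi].
      rewrite in_itv/=; apply/andP; split; first exact: mulr_ge0.
      exact: le_trans (ltW lt_r) (le_trans r1 pi1).
    by rewrite ltr_cos.
  have c0 : 0 <= cos (expR (- n%:R) : R).
    apply: cos_ge0_pihalf; apply/andP; split.
      by rewrite (@le_trans _ _ 0)// oppr_le0 divr_ge0.
    by apply: (le_trans r1); rewrite ler_pdivlMr// mul1r pi_ge2.
  apply: ler_pM; [exact: expR_ge0|exact: c0| |exact: c1].
  by rewrite ler_expR -[leLHS]mulrN1 ler_wpM2l// cos_geN1.
- move=> th _; rewrite [leLHS](ReE (- n%:R) th) -[leRHS]mulr1.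
  apply: (@le_trans _ _ (expR (expR (- n%:R) * cos th) * 1)).
    by rewrite ler_wpM2l ?expR_ge0// cos_le1.
  by rewrite ler_wpM2r// ler_expR -[leRHS]mulr1 ler_wpM2l// cos_le1.
Qed.

(** Integration by parts along the arc: the derivative of e^s s^(-b) with respect
    to th is i times e^s s^(1 - b) - b e^s s^(-b). *)
Lemma hankel_rec b y :
  arc_int pi (hankel (b - 1)) y - b * arc_int pi (hankel b) y = Im (hankel b y pi).
Proof.
have hF := holoM (holo_exp (@holo_spow R pi 1)) (@holo_spow R pi (- b)).
pose g th := Re (hankel (b - 1) y th) - b * Re (hankel b y th).
have c1 : {in `[0, pi], continuous (fun th => Re (hankel (b - 1) y th) : R)}.
  by apply: holomorphic_Re; exact: holomorphic_hankel.
have c2 : {in `[0, pi], continuous (fun th => Re (hankel b y th) : R)}.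
  by apply: holomorphic_Re; exact: holomorphic_hankel.
have c3 : {in `[0, pi], continuous (fun th => - b * Re (hankel b y th) : R)}.
  by move=> th h; apply: cvgM; [exact: cvg_cst|exact: c2].
rewrite -mulNr -sintZ// -sintD//.
rewrite (sint_FTC (F := fun th => Im (hankel b y th)))//.
- by rewrite Im_hankel_0 subr0.
- by move=> th h; apply: cvgD; [exact: c1|exact: c3].
- move=> th thpi; have [_ _ _ [_ h]] := hF y th thpi.
  apply: (is_derive_eq h).
  have -> : hankel (b - 1) y th = spow 1 y th * hankel b y th.
    by rewrite /hankel opprB spowD mulrCA.
  have ImiE (z : R[i]) : Im ('i * z) = Re z by case: z => p q /=; rewrite mul0r add0r mul1r.
  rewrite ImiE /hankel.
  move: (cexp (spow 1 y th)) (spow 1 y th) (spow (- b) y th) => [e1 e2] [s1 s2] [t1 t2] /=.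
  by ring.
Qed.

(** Hankel's formula, by induction on the integer part of b: the end point term
    in hankel_rec vanishes as the radius grows, and both sides of the recursion match
    Gamma (1 + b) = b Gamma b. *)
Lemma cvg_hankel b : -1 < b ->
  arc_int pi (hankel b) n%:R @[n --> \oo] --> (pi / Gamma (1 + b) : R).
Proof.
move=> b1.
have [m] : exists m : nat, b <= m%:R.
  by exists (Num.truncn b).+1; rewrite ltW// truncnS_gt.
elim: m b b1 => [|m IH] b b1 bm.
  move: bm; rewrite le_eqVlt => /predU1P[->|b0]; first exact: cvg_hankel0.
  by apply: cvg_hankel_neg; rewrite b1.
have [b0|b0] := leP b 0.
  move: b0; rewrite le_eqVlt => /predU1P[->|b0]; first exact: cvg_hankel0.
  by apply: cvg_hankel_neg; rewrite b1.
have {}IH : arc_int pi (hankel (b - 1)) n%:R @[n --> \oo] --> (pi / Gamma b : R).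
  have -> : Gamma b = Gamma (1 + (b - 1)) by rewrite addrC subrK.
  apply: IH; first lra.
  by rewrite lerBlDr -natr1 in bm *.
have E n : arc_int pi (hankel b) n%:R = b^-1 * (arc_int pi (hankel (b - 1)) n%:R - Im (hankel b n%:R pi)).
  by rewrite -hankel_rec opprB addrC subrK mulKf// gt_eqF.
rewrite (_ : (fun n => _) = fun n => b^-1 * (arc_int pi (hankel (b - 1)) n%:R - Im (hankel b n%:R pi))); last exact/funext.
have -> : pi / Gamma (1 + b) = b^-1 * (pi / Gamma b - 0).
  by rewrite addrC gamma_rec// subr0 invfM mulrCA.
apply: cvgM; first exact: cvg_cst.
apply: cvgB => //.
have h := cvg_expRN b0.
apply: norm_cvg0; apply: (squeeze_cvgr _ (cvg_cst 0) h).
apply: nearW => n; apply/andP; split; first exact: normr_ge0.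
rewrite Im_hankel_pi normrM.
rewrite -[leRHS]mul1r ler_pM//; first exact: sin_max.
rewrite ger0_norm ?lgi_ge0// ler_expR mulNr gerBl; exact: expR_ge0.
Qed.

End Hankel.

(** * The angle pi a *)

Section Angle.
Variable R : realType.
Variable a : R.
Hypotheses (a0 : 0 < a) (a2 : a <= 2^-1).

Lemma sin_pi_mul_gt0 : 0 < sin (pi * a).
Proof.
have p := pi_gt0 R.
apply: sin_gt0_pi; rewrite mulr_gt0//= -[ltRHS]mulr1 ltr_pM2l//.
by apply: (le_lt_trans a2); rewrite invf_lt1 ?ltr1n.
Qed.

Lemma cos_pi_mul_ge0 : 0 <= cos (pi * a).
Proof.
have p := pi_gt0 R.
apply: cos_ge0_pihalf; apply/andP; split.
  by rewrite (@le_trans _ _ 0) ?oppr_le0 ?divr_ge0 ?mulr_ge0// ltW.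
by rewrite ler_pM2l.
Qed.

End Angle.

(** * The Mittag-Leffler series as a limit of arcs *)

Section MittagLefflerSeries.
Set Implicit Arguments.
Unset Strict Implicit.
Variable R : realType.
Local Open Scope complex_scope.
Local Notation Re := complex.Re.
Local Notation Im := complex.Im.
Local Notation normc := (@Normc.normc R).
Notation D f x l := (is_derive (x : R) (1 : R) (f : R -> R) (l : R)).
Implicit Types (b c k l y th al : R) (n m : nat).

(** For w = x s^(-a) this bounds 1 / (1 + w) by 1 far from the origin and by
    1 / |w| near it. *)
Lemma normc_1D_ge (w : R[i]) : 0 <= Re w -> 1 <= normc (1 + w) /\ normc w <= normc (1 + w).
Proof.
move=> w0; split.
- apply: le_trans (norm_Re_le _); apply: le_trans (ler_norm _).
  by rewrite cReD /= lerDl.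
- rewrite !normcE_sqr ler_wsqrtr// cReD cImD /= add0r lerD2r.
  by rewrite lerXn2r ?nnegrE ?addr_ge0// lerDr.
Qed.

Lemma normcX (z : R[i]) n : normc (z ^+ n) = normc z ^+ n.
Proof.
elim: n => [|n IH]; first by rewrite !expr0 Normc.normc1.
by rewrite !exprS Normc.normcM IH.
Qed.

Lemma holomorphicX al F n : @holomorphic R al F ->
  holomorphic al (fun y th => F y th ^+ n).
Proof.
move=> hF; elim: n => [|n IH].
  have -> : (fun y th => F y th ^+ 0) = (fun _ _ => 1) by apply/funext => y; apply/funext => th.
  exact: holomorphic_cst.
have -> : (fun y th => F y th ^+ n.+1) = (fun y th => F y th * F y th ^+ n).
  by apply/funext => y; apply/funext => th; rewrite exprS.
exact: holomorphicM.
Qed.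

Variables (a x : R).
Hypotheses (a0 : 0 < a) (a2 : a <= 2^-1) (x0 : 0 < x).

Let pi0 : 0 <= pi :> R. Proof. exact: pi_ge0. Qed.

Let w y th : R[i] := x%:C * spow (- a) y th.

Let Re_w_ge0 y th : 0 <= th <= pi -> 0 <= Re (w y th).
Proof.
move=> /andP[th0 thpi].
rewrite /w /= mul0r subr0 mulr_ge0 ?mulr_ge0 ?expR_ge0 ?(ltW x0)//.
rewrite mulNr cosN cos_ge0_pihalf//; apply/andP; split.
  by rewrite (@le_trans _ _ 0) ?oppr_le0 ?divr_ge0// mulr_ge0// ltW.
by rewrite mulrC ler_pM// ltW.
Qed.

Let w1_neq0 y th : 0 <= th <= pi -> 1 + w y th != 0.
Proof.
move=> /(Re_w_ge0 y) /normc_1D_ge[h _]; apply/eqP => e.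
by move: h; rewrite e Normc.normc0 ler10.
Qed.

Let normc_w y th : normc (w y th) = x * expR (- a * y).
Proof. by rewrite Normc.normcM normc_real normc_spow gtr0_norm. Qed.

(** What is left of e^s / (1 + w), with w = x s^(-a), after m terms of the
    geometric series; ml_rem 0 is the whole function. *)
Definition ml_rem m y th : R[i] :=
  cexp (spow 1 y th) * (- w y th) ^+ m * (1 + w y th)^-1.

Let holomorphic_w : holomorphic pi w.
Proof. by apply: holomorphicM; [exact: holomorphic_cst|exact: holomorphic_spow]. Qed.

Lemma holomorphic_ml_rem m : holomorphic pi (ml_rem m).
Proof.
apply: holomorphicM; last first.
  apply: holomorphicV; first by move=> y th; exact: w1_neq0.
  by apply: holomorphicD; [exact: holomorphic_cst|exact: holomorphic_w].
apply: holomorphicM; first exact: holomorphic_exp_spow1.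
apply: holomorphicX.
have -> : (fun y th => - w y th) = (fun y th => (-1) * w y th).
  by apply/funext => y; apply/funext => th; rewrite mulN1r.
by apply: holomorphicM; [exact: holomorphic_cst|exact: holomorphic_w].
Qed.

Let normc_ml_rem m y th : 0 <= th <= pi ->
  normc (ml_rem m y th) <= expR (Re (spow 1 y th)) * (x * expR (- a * y)) ^+ m.
Proof.
move=> hth; have [h _] := normc_1D_ge (Re_w_ge0 y hth).
rewrite !Normc.normcM Normc.normcV normcX normc_opp normc_w normc_cexp.
rewrite ler_pdivrMr ?(lt_le_trans _ h)// ler_peMr// mulr_ge0 ?expR_ge0//.
by rewrite exprn_ge0// mulr_ge0 ?expR_ge0 ?ltW.
Qed.

Let pi_itv : 0 <= (pi : R) <= pi. Proof. by rewrite pi0 lexx. Qed.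

Let spow_pow b n y th : spow (- b) y th ^+ n = spow (- (b * n%:R)) y th :> R[i].
Proof.
elim: n => [|n IH]; first by rewrite mulr0 oppr0 spow0 expr0.
have e : - (b * n.+1%:R) = - b + - (b * n%:R) by rewrite -natr1; ring.
by rewrite exprS IH e spowD.
Qed.

Lemma arc_ml_rem_rec m y : arc_int pi (ml_rem m) y =
  (- x) ^+ m * arc_int pi (hankel (a * m%:R)) y + arc_int pi (ml_rem m.+1) y.
Proof.
pose H y th : R[i] := ((- x) ^+ m)%:C * hankel (a * m%:R) y th.
have hH : holomorphic pi H.
  by apply: holomorphicM; [exact: holomorphic_cst|exact: holomorphic_hankel].
have -> : (- x) ^+ m * arc_int pi (hankel (a * m%:R)) y = arc_int pi H y.
  rewrite /arc_int -sintZ; last by apply: holomorphic_Re; exact: holomorphic_hankel.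
  by apply: eq_sint => th _; rewrite cReM /= mul0r subr0.
rewrite -arc_intD//; last exact: holomorphic_ml_rem.
apply: eq_sint => th hth; congr complex.Re.
have n0 := w1_neq0 y hth.
have -> : H y th = cexp (spow 1 y th) * (- w y th) ^+ m.
  have -> : - w y th = (- x)%:C * spow (- a) y th.
    by rewrite (rmorphN (real_complex R)) mulNr.
  by rewrite exprMn spow_pow -(rmorphXn (real_complex R)) mulrCA.
by rewrite /ml_rem exprS; field.
Qed.

Lemma arc_ml_rem_series m y : arc_int pi (ml_rem 0) y =
  \sum_(0 <= k < m) (- x) ^+ k * arc_int pi (hankel (a * k%:R)) y + arc_int pi (ml_rem m) y.
Proof.
elim: m => [|m IH]; first by rewrite big_nil add0r.
by rewrite big_nat_recr//= -addrA -arc_ml_rem_rec.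
Qed.

(** The integrand is real on the positive axis. *)
Let Im_rem_0 m y : Im (ml_rem m y 0) = 0.
Proof.
rewrite /ml_rem /w !spow_th0 cexp_real.
set e := expR (- a * y).
have -> : - (x%:C * e%:C) = (- (x * e))%:C by apply/eqP; rewrite eq_complex /=; apply/andP; split; apply/eqP; ring.
have -> : 1 + x%:C * e%:C = (1 + x * e)%:C by apply/eqP; rewrite eq_complex /=; apply/andP; split; apply/eqP; ring.
rewrite -(rmorphXn (real_complex R)) !cImM cImV /=.
by rewrite !(mul0r, mulr0, oppr0, addr0).
Qed.

Let Im_rem_pi_le m y : `|Im (ml_rem m y pi)| <= expR (- expR y) * (x * expR (- a * y)) ^+ m.
Proof.
apply: le_trans (norm_Im_le _) _; apply: le_trans (normc_ml_rem _ _ pi_itv) _.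
by rewrite spow1_pi.
Qed.

Let cont_Im m : continuous (fun y => Im (ml_rem m y pi) : R).
Proof. by apply: (holomorphic_Im (holomorphic_ml_rem m)); exact: pi_itv. Qed.

Definition ml_density y : R :=
  expR (- expR y) * ((expR (a * y) / x) * sin (pi * a) /
   ((expR (a * y) / x + cos (pi * a)) ^+ 2 + sin (pi * a) ^+ 2)).

(** At th = pi the power s^(-a) is e^(- a y) e^(- i pi a); the fraction is then
    multiplied through by (e^(a y) / x)^2. *)
Lemma Im_ml_rem0_pi y : Im (ml_rem 0 y pi) = ml_density y.
Proof.
have n0 : (1 + x * (expR (- a * y) * cos (- a * pi))) ^+ 2 + (x * (expR (- a * y) * sin (- a * pi))) ^+ 2 != 0.
  have := w1_neq0 y pi_itv => /normc2_neq0.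
  by rewrite cReD cImD /w cReM cImM /= !mul0r subr0 addr0 add0r.
rewrite /ml_density /ml_rem expr0 mulr1 spow1_pi cexp_real cImM /= mul0r addr0 mulrN.
rewrite !mul0r subr0 addr0 add0r.
move: n0; rewrite !mulNr sinN cosN (mulrC pi) (expRN (a * y)).
have e0 : expR (a * y) != 0 by rewrite gt_eqF// expR_gt0.
set E := expR (a * y); set C := cos _; set S := sin _ => n0.
have x0' : x != 0 by rewrite gt_eqF.
have n1 : (E + C * x) ^+ 2 + (S * x) ^+ 2 != 0.
  rewrite (_ : _ + _ = E ^+ 2 * ((1 + x * (E^-1 * C)) ^+ 2 + (x * (E^-1 * - S)) ^+ 2)); last by field.
  by apply: mulf_neq0; [exact: expf_neq0|exact: n0].
move: (expR (- expR y)) => U.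
by field; rewrite x0' n1 e0.
Qed.

Let Q := ml_density.

Let Q_cont : continuous Q.
Proof.
have -> : Q = fun y => Im (ml_rem 0 y pi) by apply/funext => y; rewrite Im_ml_rem0_pi.
exact: cont_Im.
Qed.

Let Q_ge0 y : 0 <= Q y.
Proof.
rewrite mulr_ge0 ?expR_ge0// divr_ge0 ?addr_ge0 ?sqr_ge0//.
rewrite mulr_ge0 ?divr_ge0 ?expR_ge0 ?(ltW x0)//.
exact/ltW/sin_pi_mul_gt0.
Qed.

Let arc_rem_sub m y1 y2 : y1 <= y2 ->
  arc_int pi (ml_rem m) y2 = arc_int pi (ml_rem m) y1 + sint y1 y2 (fun y => Im (ml_rem m y pi)).
Proof.
move=> y12; apply/eqP; rewrite addrC -subr_eq arc_int_sub//; last exact: holomorphic_ml_rem.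
by apply/eqP; apply: eq_sint => y _; rewrite Im_rem_0 subr0.
Qed.

(** On the circle of radius e^N, chosen with x e^(- a N) <= 1/2, the remainder is
    at most exp (e^N) 2^(-m), a useful bound only because N is fixed.  From there
    on the sector theorem expresses the change of the arc by boundary values on
    the negative axis, where |e^s| is small and the remainder integrable. *)
Lemma arc_ml_rem_bound : exists C N, forall m n, (N <= n)%N ->
  `|arc_int pi (ml_rem m) n%:R| <= C * (2^-1) ^+ m.
Proof.
(* Any N >= ln (2 x) / a makes x e^(- a N) <= 1/2. *)
pose N := (Num.truncn (ln (2 * x) / a)).+1.
have hN y : N%:R <= y -> x * expR (- a * y) <= 2^-1.
  move=> Ny; rewrite mulNr expRN ler_pdivrMr ?expR_gt0//.
  suff : 2 * x <= expR (a * y) by lra.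
  have h : ln (2 * x) <= a * y.
    have : ln (2 * x) / a <= N%:R by rewrite ltW// truncnS_gt.
    by move=> /le_trans /(_ Ny); rewrite ler_pdivrMr// (mulrC y).
  by rewrite -[leLHS]lnK ?posrE ?mulr_gt0// ler_expR.
exists (expR (expR N%:R) * pi + 1), N => m n Nn.
have Nn' : N%:R <= n%:R :> R by rewrite ler_nat.
have geom y : N%:R <= y -> (x * expR (- a * y)) ^+ m <= (2^-1) ^+ m.
  move=> Ny; apply: lerXn2r; last exact: hN.
  - by rewrite nnegrE mulr_ge0 ?expR_ge0// ltW.
  - by rewrite nnegrE.
rewrite (arc_rem_sub _ Nn') mulrDl mul1r; apply: le_trans (ler_normD _ _) _; apply: lerD.
- rewrite mulrAC; apply: arc_int_le => //; first exact: holomorphic_ml_rem.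
  move=> th hth; apply: le_trans (normc_ml_rem _ _ hth) _.
  apply: ler_pM; rewrite ?expR_ge0 ?exprn_ge0 ?mulr_ge0 ?expR_ge0 ?(ltW x0)//; last exact: geom.
  by rewrite -normc_cexp normc_exp_spow1.
- have dE (y : R) : D (fun y => - expR (- y)) y (expR (- y)).
    have d : D (fun y => - y) y (- 1) by exact: is_deriveN.
    apply: (is_derive_eq (is_deriveN (derive_expR_comp d))).
    by rewrite mulrN1 opprK.
  have cE : continuous (fun y => expR (- y) : R).
    move=> y; have d : D (fun y => - y) y (- 1) by exact: is_deriveN.
    exact: is_derive_continuous (derive_expR_comp d).
  apply: (@le_trans _ _ (sint N%:R n%:R (fun y => (2^-1) ^+ m * expR (- y)))).
    apply: sint_norm_le_fun.
    + by move=> y _; exact: cont_Im.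
    + by move=> y _; apply: cvgM; [exact: cvg_cst|exact: cE].
    + move=> y; rewrite in_itv/= => /andP[Ny _].
      apply: le_trans (Im_rem_pi_le _ _) _; rewrite mulrC.
      apply: ler_pM; rewrite ?expR_ge0 ?exprn_ge0 ?mulr_ge0 ?expR_ge0 ?(ltW x0)//; first exact: geom.
      (* exp (- e^y) <= exp (- y), whose integral over [N, n] is at most 1. *)
      rewrite ler_expR lerN2; apply: le_trans (expR_ge1Dx _); lra.
  rewrite sintZ; last by move=> y _; exact: cE.
  rewrite -[leRHS]mulr1 ler_wpM2l ?exprn_ge0//.
  have -> : sint N%:R n%:R (fun y => expR (- y)) = - expR (- n%:R) - - expR (- N%:R).
    by apply: (sint_FTC (F := fun y => - expR (- y))) => [|t _|t _]; [exact: Nn'|exact: cE|exact: dE].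
  rewrite opprK addrC; apply: (@le_trans _ _ (expR (- N%:R))).
    by rewrite gerBl expR_ge0.
  by rewrite -[leRHS]expR0 ler_expR oppr_le0.
Qed.

(** Near the origin |1 + w| >= |w| makes the integrand O(|s|^a). *)
Let arc_rem0_cvgNy : arc_int pi (ml_rem 0) (- n%:R) @[n --> \oo] --> (0 : R).
Proof.
rewrite -(mul0r pi) -[X in X * pi]/(Re (0 : R[i])).
apply: (arc_int_cvg (eps := fun n => expR 1 / x * expR (- (a * n%:R)))) => //.
- exact: holomorphic_ml_rem.
- move=> n th _ hth; rewrite subr0.
  have [h1 h2] := normc_1D_ge (Re_w_ge0 (- n%:R) hth).
  rewrite /ml_rem expr0 mulr1 Normc.normcM Normc.normcV.
  rewrite ler_pdivrMr ?(lt_le_trans _ h1)//.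
  apply: (@le_trans _ _ (expR 1)).
    apply: le_trans (normc_exp_spow1 _ _) _.
    by rewrite ler_expR -[leRHS]expR0 ler_expR oppr_le0.
  rewrite normc_w in h2.
  apply: le_trans (ler_wpM2l _ h2); last by rewrite mulr_ge0 ?divr_ge0 ?expR_ge0// ltW.
  have e : expR (- (a * n%:R)) * expR (- a * - n%:R) = 1.
    by rewrite -expRD mulrNN addNr expR0.
  rewrite [leRHS](_ : _ = expR 1 * (expR (- (a * n%:R)) * expR (- a * - n%:R))).
    by rewrite e mulr1.
  by field; rewrite gt_eqF.
- rewrite -(mulr0 (expR 1 / x)); apply: cvgM; first exact: cvg_cst.
  exact: cvg_expRN.
Qed.

Let arc_rem0_symm n : arc_int pi (ml_rem 0) n%:R =
  arc_int pi (ml_rem 0) (- n%:R) + symm_int Q n.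
Proof.
rewrite (arc_rem_sub 0 (natr_symm R n)); congr (_ + _).
by apply: eq_sint => y _; rewrite Im_ml_rem0_pi.
Qed.

(** The density is nonnegative, and its integrals are differences of a large arc,
    bounded by arc_ml_rem_bound with m = 0, and an arc inside the unit disc. *)
Let symm_Q_cvg : exists g, symm_int Q n @[n --> \oo] --> (g : R).
Proof.
have [C [N hC]] := arc_ml_rem_bound.
have ndQ n m : (n <= m)%N -> symm_int Q n <= symm_int Q m.
  apply: (nondecreasing_exhaustion (@homo_natrN R) (@homo_natr R) (setT_bigcup_itv R)).
  - by move=> t _; exact: Q_ge0.
  - by move=> t _; exact: Q_cont.
have hb n : symm_int Q n <= C + expR 1 * pi.
  apply: le_trans (ndQ n (n + N)%N (leq_addr _ _)) _.
  set k := (n + N)%N.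
  have -> : symm_int Q k = arc_int pi (ml_rem 0) k%:R - arc_int pi (ml_rem 0) (- k%:R).
    by rewrite arc_rem0_symm addrC addKr.
  apply: le_trans (ler_norm _) _; apply: le_trans (ler_normB _ _) _; apply: lerD.
    by have := hC 0%N k (leq_addl _ _); rewrite expr0 mulr1.
  apply: arc_int_le => //; first exact: holomorphic_ml_rem.
  move=> th hth; apply: le_trans (normc_ml_rem _ _ hth) _.
  rewrite expr0 mulr1 -normc_cexp; apply: le_trans (normc_exp_spow1 _ _) _.
  by rewrite ler_expR -[leRHS]expR0 ler_expR oppr_le0.
apply: (is_cvg_exhaustion (@homo_natrN R) (@homo_natr R) (setT_bigcup_itv R) _ _ hb).
- by move=> t _; exact: Q_ge0.
- by move=> t _; exact: Q_cont.
Qed.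

(** For fixed m let the radius tend to infinity in arc_ml_rem_series: the bound
    on the remainder survives, so that the partial sums of the series approach
    the integral of the density geometrically.  The convergence of the series
    is obtained at the same time. *)
Lemma cvg_ml_density : symm_int ml_density n @[n --> \oo] --> pi * mittag_leffler a (- x).
Proof.
have [g hg] := symm_Q_cvg.
suff -> : mittag_leffler a (- x) = g / pi by rewrite mulrC divfK// gt_eqF// pi_gt0.
have [C [N hC]] := arc_ml_rem_bound.
have arc0 : arc_int pi (ml_rem 0) n%:R @[n --> \oo] --> g.
  have -> : (fun n => arc_int pi (ml_rem 0) n%:R) =
      (fun n => arc_int pi (ml_rem 0) (- n%:R) + symm_int Q n).
    by apply/funext => n; exact: arc_rem0_symm.
  by rewrite -[X in _ --> X]add0r; apply: cvgD.
have ak (k : nat) : -1 < a * k%:R by rewrite (@lt_le_trans _ _ 0)// ?ltrN10// mulr_ge0// ltW.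
pose S m := series (mittag_leffler_coeff a (- x)) m.
have sumc m : \sum_(0 <= k < m) (- x) ^+ k * arc_int pi (hankel (a * k%:R)) n%:R
    @[n --> \oo] --> pi * S m.
  elim: m => [|m IH].
    rewrite /S /series/= big_nil mulr0.
    by under eq_fun do rewrite big_nil; exact: cvg_cst.
  have -> : pi * S m.+1 = pi * S m + (- x) ^+ m * (pi / Gamma (1 + a * m%:R)).
    by rewrite /S /series/= big_nat_recr//= mulrDr /mittag_leffler_coeff mulrCA.
  rewrite (_ : (fun n => _) = (fun n => \sum_(0 <= k < m) (- x) ^+ k * arc_int pi (hankel (a * k%:R)) n%:R
     + (- x) ^+ m * arc_int pi (hankel (a * m%:R)) n%:R)); last first.
    by apply/funext => n; rewrite big_nat_recr.
  apply: cvgD => //; apply: cvgM; first exact: cvg_cst.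
  exact: cvg_hankel.
have bound m : `|g - pi * S m| <= C * (2^-1) ^+ m.
  have h : `|arc_int pi (ml_rem 0) n%:R -
      \sum_(0 <= k < m) (- x) ^+ k * arc_int pi (hankel (a * k%:R)) n%:R|
      @[n --> \oo] --> `|g - pi * S m|.
    by apply: cvg_norm; apply: cvgB => //; exact: sumc.
  apply: (ler_cvg_to h (cvg_cst _)); exists N => // n /= Nn.
  rewrite (arc_ml_rem_series m) /= addrAC subrr add0r.
  exact: hC.
have e0 : C / pi * (2^-1) ^+ m @[m --> \oo] --> (0 : R).
  rewrite -(mulr0 (C / pi)); apply: cvgM; first exact: cvg_cst.
  by apply: cvg_expr; rewrite ger0_norm ?invr_ge0// invf_lt1// ltr1n.
apply/cvg_lim => //.
apply/subr_cvg0; apply: norm_cvg0; apply: (squeeze_cvgr _ (cvg_cst 0) e0).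
apply: nearW => m; apply/andP; split; first exact: normr_ge0.
have p := pi_gt0 R.
rewrite mulrAC ler_pdivlMr// -{2}(gtr0_norm p) -normrM mulrBl divfK ?gt_eqF//.
by rewrite distrC (mulrC _ pi); exact: bound.
Qed.

End MittagLefflerSeries.

(** * The change of variables to the tangent range *)

Section ChangeOfVariables.
Set Implicit Arguments.
Unset Strict Implicit.
Variable R : realType.
Notation D f x l := (is_derive (x : R) (1 : R) (f : R -> R) (l : R)).
Implicit Types (t y : R).
Variables (a x : R).
Hypotheses (a0 : 0 < a) (a2 : a <= 2^-1) (x0 : 0 < x).

Let s := sin (pi * a).
Let c := cos (pi * a).

Let s_gt0 : 0 < s.
Proof. exact: sin_pi_mul_gt0. Qed.

Let c_ge0 : 0 <= c.
Proof. exact: cos_pi_mul_ge0. Qed.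

(** The inverse of the map t |-> x (sin (pi a) / t - cos (pi a)) = e^(a y); it is
    decreasing in y. *)
Definition ml_subst y : R := s / (expR (a * y) / x + c).

Let den_gt0 y : 0 < expR (a * y) / x + c.
Proof. by rewrite ltr_wpDr// divr_gt0// expR_gt0. Qed.

Let dml_subst y : R := - (s * (expR (a * y) * a / x) / (expR (a * y) / x + c) ^+ 2).

Let derive_ml_subst y : D ml_subst y (dml_subst y).
Proof.
have d1 := deriveM_real (derive_expR_comp (derive_mull a y)) (is_derive_cst x^-1 y (1 : R)).
have d2 : D (fun y => expR (a * y) / x + c) y (expR (a * y) * a / x).
  apply: (is_derive_eq (is_deriveD d1 (is_derive_cst c y (1 : R)))).
  by rewrite mulr0 !addr0.
have d3 := deriveV_real (f := fun y => expR (a * y) / x + c) (lt0r_neq0 (den_gt0 y)) d2.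
apply: (is_derive_eq (deriveM_real (is_derive_cst s y (1 : R)) d3)).
by rewrite /dml_subst /=; ring.
Qed.

Let continuous_den y : {for y, continuous (fun y => expR (a * y) / x + c : R)}.
Proof.
apply: cvgD; last exact: cvg_cst.
by apply: cvgM; [exact: continuous_expR_mul|exact: cvg_cst].
Qed.

Let continuous_dml_subst : continuous dml_subst.
Proof.
move=> y; apply: cvgN; apply: cvgM.
  apply: cvgM; first exact: cvg_cst.
  apply: cvgM; last exact: cvg_cst.
  by apply: cvgM; [exact: continuous_expR_mul|exact: cvg_cst].
apply: cvgV; first by rewrite expf_neq0// gt_eqF.
by apply: cvgM; exact: continuous_den.
Qed.

Let decr_ml_subst : {homo ml_subst : y z /~ y < z}.
Proof.
move=> y z yz; rewrite /ml_subst ltr_pM2l// ltf_pV2 ?posrE//.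
by rewrite ltrD2r ltr_pM2r ?invr_gt0// ltr_expR ltr_pM2l.
Qed.

Let wdecr_ml_subst y z : y <= z -> ml_subst z <= ml_subst y.
Proof. by rewrite le_eqVlt => /predU1P[->//|/decr_ml_subst/ltW]. Qed.

Definition ml_integrand t : R :=
  expR (- (x * (sin (pi * a) / t - cos (pi * a))) `^ (1 / a)) / (1 + t ^+ 2).

(** The range of ml_subst.  Written without division it also covers a = 1/2,
    where cos (pi a) = 0 and the range is the whole positive half line. *)
Let pos_dom t := (0 < t) && (c * t < s).

(** On the range of integration the base of the power is positive, which keeps
    the integrand away from the default value of powR. *)
Let base_gt0 t : pos_dom t -> 0 < x * (s / t - c).
Proof. by move=> /andP[t0 ct]; rewrite mulr_gt0// subr_gt0 ltr_pdivlMr. Qed.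

Let subst_density y : ml_integrand (ml_subst y) * - dml_subst y = a * ml_density a x y.
Proof.
rewrite /ml_integrand /ml_subst -/s -/c.
have e : x * (s / (s / (expR (a * y) / x + c)) - c) = expR (a * y).
  have d := den_gt0 y.
  have n2 : expR (a * y) + c * x != 0.
    by rewrite gt_eqF// ltr_wpDr ?mulr_ge0 ?expR_gt0// ltW.
  by field; rewrite n2 (lt0r_neq0 x0) (lt0r_neq0 s_gt0).
rewrite e powR_expR (_ : 1 / a * (a * y) = y); last by field; rewrite gt_eqF.
rewrite /dml_subst opprK /ml_density -/s -/c.
have d := den_gt0 y; have E0 := expR_gt0 (a * y).
move: (expR (- expR y)) (expR (a * y)) d E0 => U E d E0.
have n1 : (E + c * x) ^+ 2 + (s * x) ^+ 2 != 0.
  by rewrite gt_eqF// ltr_wpDr ?sqr_ge0// exprn_gt0// ltr_wpDr ?mulr_ge0// ltW.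
have n2 : E + c * x != 0 by rewrite gt_eqF// ltr_wpDr ?mulr_ge0// ltW.
by field; rewrite n1 n2 lt0r_neq0.
Qed.

Let pos_dom_subst t n : t \in `[ml_subst n%:R, ml_subst (- n%:R)] -> pos_dom t.
Proof.
rewrite in_itv/= => /andP[h1 h2]; apply/andP; split.
  by apply: lt_le_trans h1; rewrite divr_gt0.
apply: le_lt_trans (ler_wpM2l c_ge0 h2) _.
rewrite /ml_subst mulrCA -[ltRHS]mulr1 ltr_pM2l// ltr_pdivrMr// mul1r.
by rewrite ltrDr divr_gt0// expR_gt0.
Qed.

Let bigcup_ml_subst : [set t | pos_dom t] =
  \bigcup_n `[ml_subst n%:R, ml_subst (- n%:R)]%classic.
Proof.
apply/seteqP; split => t /=; last by move=> [n _] /pos_dom_subst.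
move=> ht; have B0 := base_gt0 ht.
(* The preimage of t under ml_subst. *)
pose y := ln (x * (s / t - c)) / a.
have ty : t = ml_subst y.
  rewrite /ml_subst /y mulrCA divff ?mulr1 ?gt_eqF// lnK ?posrE//.
  move/andP: ht => [t0 _].
  by field; rewrite mulNr subrK !lt0r_neq0.
have : [set: R] y by [].
rewrite setT_bigcup_itv => -[n _ /=]; rewrite in_itv/= => /andP[h1 h2].
by exists n => //=; rewrite in_itv/= ty !wdecr_ml_subst.
Qed.

Let continuous_ml_integrand t : pos_dom t -> {for t, continuous ml_integrand}.
Proof.
move=> ht; have B0 := base_gt0 ht; have /andP[t0 _] := ht.
have tn0 := lt0r_neq0 t0.
apply: cvgM.
  have h : {for t, continuous (fun t => (x * (s / t - c)) `^ (1 / a) : R)}.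
    apply: (@continuous_comp _ _ _ (fun t => x * (s / t - c)) (fun z => z `^ (1 / a))).
      apply: cvgM; first exact: cvg_cst.
      apply: cvgB; last exact: cvg_cst.
      apply: cvgM; first exact: cvg_cst.
      by apply: cvgV => //; exact: cvg_id.
    exact: (is_derive_continuous (is_derive1_powR _ B0)).
  apply: (@continuous_comp _ _ _ (fun t => - (x * (s / t - c)) `^ (1 / a)) (@expR R)).
    exact: cvgN h.
  exact: continuous_expR.
apply: cvgV; first by rewrite gt_eqF// ltr_wpDr ?sqr_ge0.
apply: cvgD; first exact: cvg_cst.
by apply: cvgM; exact: cvg_id.
Qed.

Let ml_integrand_ge0 t : 0 <= ml_integrand t.
Proof. by rewrite divr_ge0 ?expR_ge0// addr_ge0 ?sqr_ge0. Qed.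

Lemma integral_ml_integrand :
  (\int[lebesgue_measure]_(t in [set t | pos_dom t]) (ml_integrand t)%:E =
   (a * (pi * mittag_leffler a (- x)))%:E)%E.
Proof.
apply: (integral_exhaustion (u := fun n => ml_subst n%:R) (v := fun n => ml_subst (- n%:R)) _ _ bigcup_ml_subst).
- by move=> n m nm; apply: wdecr_ml_subst; rewrite ler_nat.
- by move=> n m nm; apply: wdecr_ml_subst; rewrite lerN2 ler_nat.
- by move=> t _; exact: ml_integrand_ge0.
- by move=> t; exact: continuous_ml_integrand.
rewrite (_ : (fun n => _) = fun n => a * symm_int (ml_density a x) n).
  by apply: cvgM; [exact: cvg_cst|exact: cvg_ml_density].
apply/funext => n.
rewrite (@sint_subst_decreasing _ ml_subst dml_subst _ _ _ (natr_symm R n) derive_ml_subst)//.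
- rewrite /symm_int -sintZ; first by apply: eq_sint => y _; exact: subst_density.
  move=> y _.
  have -> : ml_density a x = (fun y => a^-1 * (ml_integrand (ml_subst y) * - dml_subst y)).
    by apply/funext => z; rewrite subst_density mulKf// gt_eqF.
  apply: cvgM; first exact: cvg_cst.
  apply: cvgM; last by apply: cvgN; exact: continuous_dml_subst.
  apply: (@continuous_comp _ _ _ ml_subst ml_integrand).
    exact: is_derive_continuous (derive_ml_subst y).
  apply: continuous_ml_integrand.
  have : [set: R] y by [].
  rewrite setT_bigcup_itv => -[m _ /=]; rewrite in_itv/= => /andP[h1 h2].
  by apply: (@pos_dom_subst _ m); rewrite in_itv/= !wdecr_ml_subst.
- by move=> t /pos_dom_subst; exact: continuous_ml_integrand.
Qed.

Lemma tan_rangeE : tan_range a = [set t | pos_dom t].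
Proof.
rewrite /tan_range /pos_dom; case: eqP => [aE|/eqP aN].
  have cE : c = 0 by rewrite /c aE cos_pihalf.
  by apply/seteqP; split => t /=; rewrite in_itv/= andbT cE mul0r s_gt0 andbT.
have a2' : a < 2^-1 by rewrite lt_neqAle aN.
have c0 : 0 < c.
  have p := pi_gt0 R.
  apply: cos_gt0_pihalf; apply/andP; split.
    by rewrite (@lt_le_trans _ _ 0) ?oppr_lt0 ?divr_gt0 ?mulr_ge0// ltW.
  by rewrite ltr_pM2l.
by apply/seteqP; split => t /=; rewrite in_itv/= /tan -/s -/c ltr_pdivlMr// (mulrC c).
Qed.

End ChangeOfVariables.

Theorem mainTheorem16 (R : realType) (a x : R)
    (ha0 : 0 < a) (ha : a <= 2^-1) (hx : 0 < x) :
  ((mittag_leffler a (- x))%:E =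
   (1 / (a * pi))%:E *
   \int[lebesgue_measure]_(t in tan_range a)
      (expR (- (x * (sin (pi * a) / t - cos (pi * a))) `^ (1 / a))
         / (1 + t ^+ 2))%:E)%E.
Proof.
rewrite (tan_rangeE ha0 ha).
rewrite [X in (_ * X)%E](integral_ml_integrand ha0 ha hx) -EFinM.
congr EFin; have p := pi_gt0 R.
have [an pn] := (lt0r_neq0 ha0, lt0r_neq0 p).
by move: (pi : R) pn (mittag_leffler _ _) => P pn M; field; rewrite pn an.
Qed.
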